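(* Let $d:\mathcal X\to\{0,1\}$ be a fixed deterministic treatment policy, let $Z=(\mathbf X,R,RA,Y)\sim\mathbb P$ arise from the missing-treatment model described in the context, and let $V(d)=\mathbb E[Y(d(\mathbf X))]$. Assume: (i) Consistency: if $A=a$, then $Y(a)=Y$; A-Ignorability: $Y(1),Y(0)\perp A\mid\mathbf X$; A-Positivity: $0<P(A=1\mid\mathbf X=\mathbf x)<1$; (ii) MCCAR: R-Ignorability $R\perp(A,Y)\mid\mathbf X$, and R-Positivity $0<P(R=1\mid\mathbf X=\mathbf x)$. Suppose that the estimators $\widehat\psi_{\mathrm{MAR}}=\mathbb P_n(\widehat\varphi_{\mathrm{MAR}})$ and $\widehat\Phi_{\mathrm{MCCAR}}=\mathbb P_n(\widehat\phi_{\mathrm{MCCAR}})$ are both asymptotically normal estimators of $V(d)$, i.e. $\sqrt n(\widehat\psi_{\mathrm{MAR}}-V(d))\rightsquigarrow\mathcal N(0,\mathrm{Var}(\varphi_{\mathrm{MAR}}))$ and $\sqrt n(\widehat\Phi_{\mathrm{MCCAR}}-V(d))\rightsquigarrow\mathcal N(0,\mathrm{Var}(\phi_{\mathrm{MCCAR}}))$. Then $\widehat\psi_{\mathrm{MAR}}$ is the more efficient estimator (i.e. $\mathrm{ARE}(\phi_{\mathrm{MCCAR}},\varphi_{\mathrm{MAR}})>1$), with asymptotic relative efficiency $$\mathrm{ARE}(\phi_{\mathrm{MCCAR}},\varphi_{\mathrm{MAR}})=\frac{\mathrm{Var}(\phi_{\mathrm{MCCAR}})}{\mathrm{Var}(\varphi_{\mathrm{MAR}})}=\left(1-\frac{\mathbb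 E\left[\left(\frac{Y-\nu_d(\mathbf X)}{\gamma_d(\mathbf X)}\right)^2\cdot\lambda_d(\mathbf X,Y)^2\cdot\left(\frac{1-\pi(\mathbf X)}{\pi(\mathbf X)}\right)\right]}{\mathrm{Var}(\phi_{\mathrm{MCCAR}})}\right)^{-1}.$$
   Context: Missing-treatment model: $\mathbf X\in\mathcal X\subseteq\mathbb R^p$ are covariates, $A\in\{0,1\}$ is a binary treatment, $Y\in\mathbb R$ is the observed outcome, $Y(0),Y(1)$ are potential outcomes, and $R\in\{0,1\}$ indicates whether $A$ is observed ($R=1$) or missing ($R=0$). The observed data are $n$ i.i.d. copies of $Z=(\mathbf X,R,RA,Y)$; $\mathbb P_n$ denotes the sample average over them. $Y(d(\mathbf X))$ is the potential outcome under the treatment assigned by $d$. Standing assumptions: $Y$ is bounded, so that the estimators have finite variance; all nuisance functions are estimated from an independent sample. Asymptotic relative efficiency: for asymptotically normal estimators $f_1,f_2$ of the same quantity, $\mathrm{ARE}(f_1,f_2)=\mathrm{Var}(f_1)/\mathrm{Var}(f_2)$ (ratio of asymptotic variances); when $\mathrm{ARE}>1$, $f_2$ is more efficient. Nuisance functions: $\nu_d(\mathbf X)=\mathbb E[Y\mid\mathbf X,A=d(\mathbf X),R=1]$; $\eta_d(\mathbf X)=P(A=d(\mathbf X),R=1\mid\mathbf X)$; $\lambda_d(\mathbf X,Y)=P(A=d(\mathbf X)\mid\mathbf X,Y,R=1)$; $\pi(\mathbf X,Y)=P(R=1\mid\mathbf X,Y)$, which under MCCAR equals $\pi(\mathbf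 X)=P(R=1\mid\mathbf X)$; $\beta_d(\mathbf X)=\mathbb E[Y\lambda_d(\mathbf X,Y)\mid\mathbf X]$; $\gamma_d(\mathbf X)=\mathbb E[\lambda_d(\mathbf X,Y)\mid\mathbf X]=P(A=d(\mathbf X)\mid\mathbf X)$. Uncentered influence functions: $$\phi_{\mathrm{MCCAR}}(Z)=\frac{R\,\mathbf 1(A=d(\mathbf X))\,(Y-\nu_d(\mathbf X))}{\eta_d(\mathbf X)}+\nu_d(\mathbf X),$$ $$\varphi_{\mathrm{MAR}}(Z)=\frac{Y-\beta_d(\mathbf X)/\gamma_d(\mathbf X)}{\gamma_d(\mathbf X)}\left(\frac{R\,(\mathbf 1(A=d(\mathbf X))-\lambda_d(\mathbf X,Y))}{\pi(\mathbf X,Y)}+\lambda_d(\mathbf X,Y)\right)+\frac{\beta_d(\mathbf X)}{\gamma_d(\mathbf X)}.$$ $\widehat\phi_{\mathrm{MCCAR}}$ and $\widehat\varphi_{\mathrm{MAR}}$ denote the same expressions with every nuisance function replaced by its estimate. $\rightsquigarrow$ denotes convergence in distribution as $n\to\infty$.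
   Formalization: ''ARE > 1'' can fail (if R=1 almost surely, the subtracted expectation is 0 and ARE=1); it is replaced by ARE ≥ 1, with ARE > 1 if and only if P(R=0, A=d(X), Y≠ν_d(X)) > 0. The ARE formula is unchanged. *)

(* Defs.v *)
From HB Require Import structures.
From mathcomp Require Import all_boot all_order all_algebra.
From mathcomp Require Import all_classical all_reals all_analysis.

Set Implicit Arguments.
Unset Strict Implicit.
Unset Printing Implicit Defensive.

Import Order.TTheory GRing.Theory Num.Theory.
Import numFieldNormedType.Exports.

Local Open Scope classical_set_scope.
Local Open Scope ring_scope.

(* [is_cexp P B W U g]: the measurable function [g] is a version of
   E[U | W = . , B], that is, of the conditional expectation of [U] given [W]
   under the conditional law P(. | B).  The normalising factor 1 / P(B) cancels
   on both sides of the defining identity, so that [g] is determined up to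
   null sets of the law of [W] given [B]. *)
Definition is_cexp {d d' : measure_display} {R : realType}
    {T : measurableType d} {S : measurableType d'} (P : probability T R)
    (B : set T) (W : T -> S) (U : T -> R) (g : S -> R) : Prop :=
  [/\ measurable_fun [set: S] g,
      P.-integrable B (EFin \o U),
      P.-integrable B (EFin \o (g \o W)) &
      forall C : set S, measurable C ->
        (\int[P]_(w in B `&` W @^-1` C) (U w)%:E =
         \int[P]_(w in B `&` W @^-1` C) (g (W w))%:E)%E].

Definition is_cprob {d d' : measure_display} {R : realType}
    {T : measurableType d} {S : measurableType d'} (P : probability T R)
    (B : set T) (W : T -> S) (E : set T) (g : S -> R) : Prop :=
  is_cexp P B W \1_E g.

(* U and V are conditionally independent given W:
   P(U in C1, V in C2 | W) = P(U in C1 | W) P(V in C2 | W) almost surely. *)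
Definition cond_indep {d d1 d2 d3 : measure_display} {R : realType}
    {T : measurableType d} {S1 : measurableType d1} {S2 : measurableType d2}
    {S3 : measurableType d3} (P : probability T R)
    (U : T -> S1) (V : T -> S2) (W : T -> S3) : Prop :=
  forall (C1 : set S1) (C2 : set S2), measurable C1 -> measurable C2 ->
    exists g1 g2 : S3 -> R,
      [/\ is_cprob P setT W (U @^-1` C1) g1,
          is_cprob P setT W (V @^-1` C2) g2 &
          is_cprob P setT W (U @^-1` C1 `&` V @^-1` C2) (g1 \* g2)].

Definition mutually_independent {d d' : measure_display} {R : realType}
    {T : measurableType d} {S : measurableType d'} (Q : probability T R)
    {I : eqType} (Z : I -> T -> S) : Prop :=
  forall (s : seq I) (C : I -> set S), uniq s ->
    (forall i, measurable (C i)) ->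
    (Q (\big[setI/setT]_(i <- s) (Z i @^-1` C i)) =
     \prod_(i <- s) Q (Z i @^-1` C i))%E.

Definition iid_copies {d d' d'' : measure_display} {R : realType}
    {T : measurableType d} {S : measurableType d'} {T0 : measurableType d''}
    (Q : probability T R) (P : probability T0 R)
    {I : eqType} (Z : I -> {RV Q >-> S}) (Z0 : T0 -> S) : Prop :=
  mutually_independent Q (fun i => Z i : T -> S) /\
  (forall (i : I) (C : set S), measurable C ->
     Q (Z i @^-1` C) = P (Z0 @^-1` C)).

Definition cvg_in_distribution {d : measure_display} {R : realType}
    {T : measurableType d} (Q : probability T R)
    (U : nat -> T -> R) (mu : probability (measurableTypeR R) R) : Prop :=
  (forall n, measurable_fun [set: T] (U n)) /\
  (forall f : R -> R, continuous f -> (exists M, forall x, `|f x| <= M) ->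
     ('E_Q[f \o U n])%E @[n --> \oo] --> (\int[mu]_x (f x)%:E)%E).

(* [v] is the asymptotic variance; [normal_prob] takes a standard deviation,
   and is a normal law only when this is nonzero. *)
Definition asymptotically_normal {d : measure_display} {R : realType}
    {T : measurableType d} (Q : probability T R)
    (est : nat -> T -> R) (theta v : R) : Prop :=
  0 < v /\
  cvg_in_distribution Q
    (fun n w => Num.sqrt n%:R * (est n w - theta))
    (normal_prob 0 (Num.sqrt v)).

(* ARE(f1, f2) = r, for estimators [f1] and [f2] of [theta]; [f2] is the more
   efficient one when 1 < r. *)
Definition is_ARE {d : measure_display} {R : realType}
    {T : measurableType d} (Q : probability T R)
    (f1 f2 : nat -> T -> R) (theta r : R) : Prop :=
  exists v1 v2 : R,
    [/\ asymptotically_normal Q f1 theta v1,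
        asymptotically_normal Q f2 theta v2 & r = v1 / v2].

(* Values of the observed data (X, R, RA, Y); the product RA of two binary
   variables is their conjunction. *)
Notation obs R p := (p.-tuple R * bool * bool * R)%type.

Definition observed {d : measure_display} {R : realType} {p : nat}
    {T : measurableType d} (X : T -> p.-tuple R) (Ro A : T -> bool)
    (Y : T -> R) : T -> obs R p :=
  fun w => (X w, Ro w, Ro w && A w, Y w).

Section assumptions.
Context {d : measure_display} {R : realType} {p : nat} {T : measurableType d}.
Variables (P : probability T R) (X : T -> p.-tuple R) (A Ro : T -> bool)
  (Y : T -> R) (Ypot : bool -> T -> R).

Definition consistency : Prop :=
  {ae P, forall w, forall a, A w = a -> Ypot a w = Y w}.

Definition A_ignorability : Prop :=
  cond_indep P (fun w => (Ypot true w, Ypot false w)) A X.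

Definition A_positivity : Prop :=
  exists e : p.-tuple R -> R,
    is_cprob P setT X [set w | A w] e /\
    {ae P, forall w, 0 < e (X w) < 1}.

Definition R_ignorability : Prop :=
  cond_indep P Ro (fun w => (A w, Y w)) X.

(* [piX] is P(R = 1 | X = .) *)
Definition R_positivity (piX : p.-tuple R -> R) : Prop :=
  is_cprob P setT X [set w | Ro w] piX /\
  {ae P, forall w, 0 < piX (X w)}.

End assumptions.

Record nuisance (R : realType) (p : nat) := Nuisance {
  nu : p.-tuple R -> R;
  eta : p.-tuple R -> R;
  lambda : p.-tuple R -> R -> R;
  pi_xy : p.-tuple R -> R -> R;
  beta : p.-tuple R -> R;
  gamma : p.-tuple R -> R }.

Record is_nuisance {d : measure_display} {R : realType} {p : nat}
    {T : measurableType d} (P : probability T R) (X : T -> p.-tuple R)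
    (A Ro : T -> bool) (Y : T -> R) (pol : p.-tuple R -> bool)
    (N : nuisance R p) : Prop := {
  nuP : is_cexp P [set w | A w = pol (X w) /\ Ro w] X Y (nu N);
  etaP : is_cprob P setT X [set w | A w = pol (X w) /\ Ro w] (eta N);
  lambdaP : is_cprob P [set w | Ro w] (fun w => (X w, Y w))
    [set w | A w = pol (X w)] (fun xy => lambda N xy.1 xy.2);
  pi_xyP : is_cprob P setT (fun w => (X w, Y w))
    [set w | Ro w] (fun xy => pi_xy N xy.1 xy.2);
  betaP : is_cexp P setT X (fun w => Y w * lambda N (X w) (Y w)) (beta N);
  gammaP : is_cexp P setT X (fun w => lambda N (X w) (Y w)) (gamma N) }.

(* In both influence functions the indicator of A = d(X) occurs multiplied by
   R, so A may be read off the observed RA. *)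
Definition phi_MCCAR {R : realType} {p : nat} (pol : p.-tuple R -> bool)
    (N : nuisance R p) (z : obs R p) : R :=
  let: (x, r, ra, y) := z in
  r%:R * (ra == pol x)%:R * (y - nu N x) / eta N x + nu N x.

Definition phi_MAR {R : realType} {p : nat} (pol : p.-tuple R -> bool)
    (N : nuisance R p) (z : obs R p) : R :=
  let: (x, r, ra, y) := z in
  (y - beta N x / gamma N x) / gamma N x *
    (r%:R * ((ra == pol x)%:R - lambda N x y) / pi_xy N x y + lambda N x y)
  + beta N x / gamma N x.

(* The estimator P_n(phi-hat): the sample average over Z_0, ..., Z_(n-1) of the
   influence function [phi] evaluated at the nuisance functions [Nhat n], which
   are estimated from the training observations Zt_0, ..., Zt_(m n - 1). *)
Definition estimator {d : measure_display} {R : realType} {p : nat}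
    {T : measurableType d} (phi : nuisance R p -> obs R p -> R)
    (m : nat -> nat) (Nhat : forall n, (m n).-tuple (obs R p) -> nuisance R p)
    (Z Zt : nat -> T -> obs R p) (n : nat) (w : T) : R :=
  n%:R^-1 * \sum_(i < n) phi (Nhat n [tuple Zt j w | j < m n]) (Z i w).

(* Main.v *)
Require Import Defs.
From HB Require Import structures.
From mathcomp Require Import all_boot all_order all_algebra.
From mathcomp Require Import all_classical all_reals all_analysis.
From mathcomp Require Import measurable_realfun.
From mathcomp Require Import ring lra.

Set Implicit Arguments.
Unset Strict Implicit.
Unset Printing Implicit Defensive.

Import Order.TTheory GRing.Theory Num.Theory.
Import numFieldNormedType.Exports.

Local Open Scope classical_set_scope.
Local Open Scope ring_scope.

(* Under MCCAR the law of (R, 1(A = d(X))) given (X, Y) is the product of two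
   Bernoulli laws, with parameters pi(X) and lambda(X, Y).  Hence
   pi(X, Y) = pi(X), eta = pi gamma and nu = beta / gamma almost surely, and
     phi_MCCAR - phi_MAR = (Y - nu) / gamma * lambda * (R / pi - 1).
   Averaging over this conditional law shows that the difference has mean zero
   and is orthogonal to phi_MAR, so Var(phi_MCCAR) exceeds Var(phi_MAR) by the
   second moment of the difference, which is the expectation in the formula for
   the ARE. *)

(** * Measures with a density *)

(** Conditional expectations are given only by integral identities over events {W in C}, and
    conditional independence only event by event, so there is no conditional law at hand to average
    over. The substitute is an exchange of weights: if the densities u and v have the same image
    under V, then u h(V) and v h(V) have the same integral for every measurable h, integrable or
    not. Each conditional law is used in this form, with u an indicator and v its conditional
    probability. Two obstacles remain. The function lambda is conditioned on R = 1 and must be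
    carried over to the whole population by dividing by pi > 0. And the nuisance functions are
    versions, which obey their bounds only almost surely; they are replaced by versions that obey
    them everywhere, so that the algebra holds pointwise. *)

Section density.
Context {d} {T : measurableType d} {R : realType} (mu : {measure set T -> \bar R}).
Variable u : T -> R.

(* The unused hypotheses make the measure structure on [density] inferable. *)
Definition density (mfu : measurable_fun [set: T] u) (u0 : forall x, 0 <= u x)
  (A : set T) : \bar R := (\int[mu]_(x in A) (u x)%:E)%E.

Hypotheses (mfu : measurable_fun [set: T] u) (u0 : forall x, 0 <= u x).
Local Notation nu := (density mfu u0).

Let density0 : nu set0 = 0%E.
Proof. by rewrite /density integral_set0. Qed.

Let density_ge0 A : (0 <= nu A)%E.
Proof. by apply: integral_ge0 => x _; rewrite lee_fin u0. Qed.

Let density_sigma_additive : semi_sigma_additive nu.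
Proof.
move=> /= F mF tF mUF; rewrite /density; apply: cvg_toP.
  apply: ereal_nondecreasing_is_cvgn => k n kn.
  by apply: lee_sum_nneg_natr => // i _ _; exact: density_ge0.
rewrite ge0_integral_bigcup//=.
- exact/measurable_funTS/measurable_EFinP.
- by move=> x _; rewrite lee_fin.
Qed.

HB.instance Definition _ := isMeasure.Build _ _ _ nu
  density0 density_ge0 density_sigma_additive.

Import HBNNSimple.

(** Monotone convergence on both sides reduces to simple functions, and on the indicator of a level
    set the claim is the definition of [density]. *)
Lemma integral_density (f : T -> R) : measurable_fun [set: T] f ->
  (forall x, 0 <= f x) ->
  (\int[nu]_x (f x)%:E = \int[mu]_x (u x * f x)%:E)%E.
Proof.
move=> mf f0.
have mEf : measurable_fun [set: T] (EFin \o f) by exact/measurable_EFinP.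
pose f_ := nnsfun_approx measurableT mEf.
have f_cvg x : (f_ n x)%:E @[n --> \oo] --> (f x)%:E.
  by apply: (cvg_nnsfun_approx measurableT mEf) => // t _; rewrite lee_fin.
have f_nd x : {homo f_ ^~ x : k n / (k <= n)%N >-> k <= n}.
  by move=> k n kn; exact/lefP/nd_nnsfun_approx.
transitivity (limn (fun n => \int[nu]_x (f_ n x)%:E)%E).
  rewrite -monotone_convergence//=.
  - by apply: eq_integral => x _; apply/esym/cvg_lim => //; exact: f_cvg.
  - by move=> n; exact/measurable_EFinP/measurable_funP.
  - by move=> n x _; rewrite lee_fin.
  - by move=> x _ k n kn; rewrite lee_fin f_nd.
rewrite [X in limn X](_ : _ = fun n => \int[mu]_x (u x * f_ n x)%:E)%E.
  rewrite -monotone_convergence//=.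
  - apply: eq_integral => x _; apply/cvg_lim => //.
    under eq_fun do rewrite EFinM.
    by rewrite EFinM; apply: cvgeZl => //; exact: f_cvg.
  - by move=> n; apply/measurable_EFinP/measurable_funM => //; exact/measurable_funP.
  - by move=> n x _; rewrite lee_fin mulr_ge0.
  - by move=> x _ k n kn; rewrite lee_fin ler_wpM2l// f_nd.
apply/funext => n.
transitivity (\sum_(k \in range (f_ n))
    k%:E * \int[nu]_x (\1_(f_ n @^-1` [set k]) x)%:E)%E.
  under eq_integral do rewrite fimfunE -fsumEFin//.
  rewrite ge0_integral_fsum//; last 2 first.
  - by move=> y; exact/measurable_EFinP/measurable_funM.
  - by move=> y x _; rewrite nnfun_muleindic_ge0.
  by apply: eq_fsbigr => r _; rewrite integralZl_indic_nnsfun.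
transitivity (\sum_(k \in range (f_ n))
    \int[mu]_x (u x * (k * \1_(f_ n @^-1` [set k]) x))%:E)%E; last first.
  rewrite -ge0_integral_fsum//; last 2 first.
  - by move=> y; apply/measurable_EFinP/measurable_funM => //; exact/measurable_funM.
  - by move=> y x _; rewrite EFinM mule_ge0 ?lee_fin// -lee_fin nnfun_muleindic_ge0.
  apply: eq_integral => x _; rewrite [in RHS]fimfunE EFinM -fsumEFin//.
  by rewrite ge0_mule_fsumr// => y; exact: nnfun_muleindic_ge0.
(* A level in the range is a value [f_ n t], hence nonnegative, so it can be taken out of the
   integral of a nonnegative function. *)
apply: eq_fsbigr => r; rewrite inE => -[t _ <-].
rewrite integral_indic// setIT.
transitivity (\int[mu]_x ((f_ n t)%:E * (u x * \1_(f_ n @^-1` [set f_ n t]) x)%:E))%E; last first.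
  by apply: eq_integral => x _; rewrite -EFinM mulrCA.
have mr : measurable_fun [set: T] (\1_(f_ n @^-1` [set f_ n t]) : T -> R) by [].
rewrite ge0_integralZl//; last 3 first.
- by apply/measurable_EFinP/measurable_funM.
- by move=> x _; rewrite lee_fin mulr_ge0.
- by rewrite lee_fin.
congr *%E; rewrite /= /density integral_mkcond; apply: eq_integral => x _.
by rewrite patchE indicE; case: ifPn => _; rewrite ?mulr1 ?mulr0.
Qed.

End density.

(* With u = U and v = E[U | V], the hypothesis on u and v below is the
   defining property of the conditional expectation. *)
Section same_weighted_law.
Context {d d' : measure_display} {T : measurableType d} {S : measurableType d'}
  {R : realType} (mu : {measure set T -> \bar R}).
Variables (u v : T -> R) (V : T -> S).
Hypotheses (mfu : measurable_fun [set: T] u) (mfv : measurable_fun [set: T] v).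
Hypotheses (u0 : forall x, 0 <= u x) (v0 : forall x, 0 <= v x).
Hypothesis mV : measurable_fun [set: T] V.
Hypothesis uv : forall C, measurable C ->
  (\int[mu]_(x in V @^-1` C) (u x)%:E = \int[mu]_(x in V @^-1` C) (v x)%:E)%E.

(** Both sides are integrals of [h] against images under [V] of measures with densities [u] and [v];
    [uv] says that these images coincide. *)
Lemma ge0_integral_weighted (h : S -> R) :
  measurable_fun [set: S] h -> (forall y, 0 <= h y) ->
  (\int[mu]_x (u x * h (V x))%:E = \int[mu]_x (v x * h (V x))%:E)%E.
Proof.
move=> mh h0.
have mhV : measurable_fun [set: T] (h \o V) by exact: measurableT_comp.
have mEh : measurable_fun [set: S] (EFin \o h) by exact/measurable_EFinP.
have E (w : T -> R) (mw : measurable_fun [set: T] w) (w0 : forall x, 0 <= w x) :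
    (\int[mu]_x (w x * h (V x))%:E =
     \int[pushforward (density mu mw w0) V]_y (h y)%:E)%E.
  transitivity (\int[density mu mw w0]_x (h (V x))%:E)%E; first exact/esym/integral_density.
  rewrite (ge0_integral_pushforward mV _ measurableT mEh)//.
  by move=> y _; rewrite lee_fin.
by rewrite (E _ mfu u0) (E _ mfv v0); apply: eq_measure_integral => A mA _; exact: uv.
Qed.

(* The integral of a function that is not integrable is the difference of the
   integrals of its positive and negative parts, so no integrability is needed. *)
Lemma integral_weighted (h : S -> R) : measurable_fun [set: S] h ->
  (\int[mu]_x (u x * h (V x))%:E = \int[mu]_x (v x * h (V x))%:E)%E.
Proof.
move=> mh; rewrite integralE [RHS]integralE.
have pos (w : T -> R) x : 0 <= w x ->
    ((fun x => (w x * h (V x))%:E)^\+ x = (w x * h^\+ (V x))%:E)%E.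
  by move=> w0; rewrite funeposE -EFin_max -[in LHS](mulr0 (w x)) -maxr_pMr.
have neg (w : T -> R) x : 0 <= w x ->
    ((fun x => (w x * h (V x))%:E)^\- x = (w x * h^\- (V x))%:E)%E.
  by move=> w0; rewrite funenegE -EFinN -EFin_max -mulrN -[in LHS](mulr0 (w x)) -maxr_pMr.
under eq_integral do rewrite pos//.
under [X in (_ - X)%E]eq_integral do rewrite neg//.
under [in RHS]eq_integral do rewrite pos//.
under [X in (_ = _ - X)%E]eq_integral do rewrite neg//.
rewrite !ge0_integral_weighted//; [exact: measurable_funrneg|exact: measurable_funrpos].
Qed.

Lemma integrable_weighted (h : S -> R) : measurable_fun [set: S] h ->
  mu.-integrable [set: T] (fun x => (u x * h (V x))%:E) ->
  mu.-integrable [set: T] (fun x => (v x * h (V x))%:E).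
Proof.
move=> mh /integrableP[_ iu]; apply/integrableP; split.
  by apply/measurable_EFinP/measurable_funM => //; exact: measurableT_comp.
under eq_integral do rewrite abse_EFin normrM (ger0_norm (v0 _)).
rewrite -(@ge0_integral_weighted (fun y => `|h y|)) => [||//]; last exact: measurableT_comp.
by under eq_integral do rewrite -(ger0_norm (u0 _)) -normrM -abse_EFin.
Qed.

End same_weighted_law.

(** Rectangles form a pi-system that generates the product sigma-algebra, and the two image measures
    agree on it. The finite total mass of [u] lets the constant sequence [setT] serve as the
    exhaustion in the uniqueness theorem. *)
Lemma weighted_rectangles {d d1 d2} {T : measurableType d} {S1 : measurableType d1}
    {S2 : measurableType d2} {R : realType} (mu : {measure set T -> \bar R})
    (u v : T -> R) (V1 : T -> S1) (V2 : T -> S2) :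
  measurable_fun [set: T] u -> measurable_fun [set: T] v ->
  (forall x, 0 <= u x) -> (forall x, 0 <= v x) ->
  measurable_fun [set: T] V1 -> measurable_fun [set: T] V2 ->
  (\int[mu]_x (u x)%:E < +oo)%E ->
  (forall C1 C2, measurable C1 -> measurable C2 ->
    \int[mu]_(x in V1 @^-1` C1 `&` V2 @^-1` C2) (u x)%:E =
    \int[mu]_(x in V1 @^-1` C1 `&` V2 @^-1` C2) (v x)%:E)%E ->
  forall C, measurable C ->
    (\int[mu]_(x in (fun x => (V1 x, V2 x)) @^-1` C) (u x)%:E =
     \int[mu]_(x in (fun x => (V1 x, V2 x)) @^-1` C) (v x)%:E)%E.
Proof.
move=> mu_ mv_ u0 v0 mV1 mV2 uoo uv C mC.
have mV : measurable_fun [set: T] (fun x => (V1 x, V2 x)).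
  exact: measurable_fun_pair.
pose G := [set A `*` B | A in @measurable _ S1 & B in @measurable _ S2].
have := @measure_unique _ R (S1 * S2)%type G (fun=> setT) _ _ _ _
  (pushforward (density mu mu_ u0) (fun x => (V1 x, V2 x)))
  (pushforward (density mu mv_ v0) (fun x => (V1 x, V2 x))) _ _ C mC.
apply => //.
- exact: measurable_prod_measurableType.
- move=> _ _ [A1 mA1 [A2 mA2 <-]] [B1 mB1 [B2 mB2 <-]].
  exists (A1 `&` B1); first exact: measurableI.
  by exists (A2 `&` B2); [exact: measurableI|rewrite setXI].
- by move=> _; exists setT => //; exists setT => //; rewrite setXTT.
- by rewrite bigcup_const.
- by move=> _ [A mA [B mB <-]]; exact: uv.
Qed.

(** * Conditional expectations *)

Lemma measurable_pred {d} {T : measurableType d} (b : T -> bool) :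
  measurable_fun [set: T] b -> measurable [set x | b x].
Proof. by move=> mb; rewrite -[X in measurable X]setTI; exact: (mb measurableT [set true]). Qed.

Section conditional_expectation.
Context {d d' : measure_display} {T : measurableType d} {S : measurableType d'}
  {R : realType} (P : probability T R) (B : set T) (W : T -> S).
Hypotheses (mB : measurable B) (mW : measurable_fun [set: T] W).

(** The defining identity is tested on the event g' < g. There g - g' is positive, yet its integral
    is that of U - U', which is at most 0; hence the event is null within [B]. *)
Lemma is_cexp_le (U U' : T -> R) (g g' : S -> R) :
  is_cexp P B W U g -> is_cexp P B W U' g' ->
  (forall w, B w -> U w <= U' w) ->
  {ae P, forall w, B w -> g (W w) <= g' (W w)}.
Proof.
move=> [mg iU ig gE] [mg' iU' ig' gE'] leU.
pose C := [set x | g' x < g x].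
have mC : measurable C by apply/measurable_pred/measurable_fun_ltr.
have mD : measurable (B `&` W @^-1` C).
  by apply: measurableI => //; rewrite -[_ @^-1` _]setTI; exact: mW.
pose f w := (g (W w) - g' (W w))%:E.
have igD : P.-integrable (B `&` W @^-1` C) (EFin \o (g \o W)).
  by apply: integrableS ig => //; exact: subIsetl.
have igD' : P.-integrable (B `&` W @^-1` C) (EFin \o (g' \o W)).
  by apply: integrableS ig' => //; exact: subIsetl.
have iUD : P.-integrable (B `&` W @^-1` C) (EFin \o U).
  by apply: integrableS iU => //; exact: subIsetl.
have iUD' : P.-integrable (B `&` W @^-1` C) (EFin \o U').
  by apply: integrableS iU' => //; exact: subIsetl.
have f0 w : (B `&` W @^-1` C) w -> (0 <= f w)%E.
  by move=> [_ /ltW Cw]; rewrite lee_fin subr_ge0.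
have intf : (\int[P]_(w in B `&` W @^-1` C) `|f w| = 0)%E.
  rewrite (eq_integral f); last by move=> w /set_mem wD; rewrite gee0_abs// f0.
  apply/eqP; rewrite eq_le integral_ge0 ?andbT//.
  under eq_integral do rewrite /f EFinB.
  rewrite integralB_EFin//= sube_le0 -gE// -gE'//.
  apply: le_integral => // w /set_mem[Bw _].
  by rewrite lee_fin leU.
have [|N [mN N0 subN]] := (ae_eq_integral_abs P mD _).1 intf.
  apply/measurable_funTS/measurable_EFinP.
  by apply: measurable_funB; exact: measurableT_comp.
exists N; split => // w /= /not_implyP[Bw /negP]; rewrite -ltNge => lt.
apply: subN => /=; apply/not_implyP; split => // -[] /eqP.
by rewrite subr_eq0 => /eqP gg'; rewrite gg' ltxx in lt.
Qed.

Lemma is_cexp_unique (U : T -> R) (g g' : S -> R) :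
  is_cexp P B W U g -> is_cexp P B W U g' ->
  {ae P, forall w, B w -> g (W w) = g' (W w)}.
Proof.
move=> h h'; have le w : B w -> U w <= U w by [].
have := is_cexp_le h h' le; have := is_cexp_le h' h le.
by apply: filterS2 => w a b Bw; apply/eqP; rewrite eq_le a// b.
Qed.

Lemma is_cexp_ae_eq (U : T -> R) (g g' : S -> R) : is_cexp P B W U g ->
  measurable_fun [set: S] g' ->
  {ae P, forall w, B w -> g (W w) = g' (W w)} -> is_cexp P B W U g'.
Proof.
move=> [mg iU ig gE] mg' gg'.
have mgW : measurable_fun B (EFin \o (g \o W)) by exact: measurable_int ig.
have mgW' : measurable_fun B (EFin \o (g' \o W)).
  by apply/measurable_funTS/measurable_EFinP/measurableT_comp.
split => //.
- apply/integrableP; split => //.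
  have /integrableP[_] := ig; congr (_ < _)%E; apply: ae_eq_integral => //.
  + exact: measurableT_comp.
  + exact: measurableT_comp.
  + by apply: filterS gg' => w h Bw; rewrite /= h.
- move=> C mC; rewrite gE//.
  have mD : measurable (B `&` W @^-1` C).
    by apply: measurableI => //; rewrite -[_ @^-1` _]setTI; exact: mW.
  apply: ae_eq_integral => //.
  + by apply: measurable_funS mgW => //; exact: subIsetl.
  + by apply: measurable_funS mgW' => //; exact: subIsetl.
  + by apply: filterS gg' => w h [Bw _]; rewrite h.
Qed.

Lemma is_cexp_cst (c : R) : is_cexp P B W (cst c) (cst c).
Proof.
have ic : P.-integrable B (EFin \o cst c).
  by apply: (@integrableS _ _ _ P setT) => //; exact: finite_measure_integrable_cst.
by split.
Qed.

Lemma is_cprob_01 (E : set T) (g : S -> R) : is_cprob P B W E g ->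
  {ae P, forall w, B w -> 0 <= g (W w) <= 1}.
Proof.
move=> h.
have h0 w : B w -> cst 0 w <= \1_E w :> R by move=> _; rewrite indicE.
have h1 w : B w -> \1_E w <= cst 1 w :> R.
  by move=> _; rewrite indicE /cst; case: (w \in E).
have := is_cexp_le (is_cexp_cst 0) h h0; have := is_cexp_le h (is_cexp_cst 1) h1.
by apply: filterS2 => w /= a b Bw; rewrite a// b.
Qed.

Lemma is_cprobC (E : set T) (g : S -> R) : is_cprob P B W E g ->
  is_cprob P B W (~` E) (fun x => 1 - g x).
Proof.
move=> [mg iE ig gE]; have [_ i1 _ _] := is_cexp_cst 1.
have EC w : \1_(~` E) w = 1 - \1_E w :> R.
  by rewrite !indicE in_setC; case: (w \in E); rewrite ?subrr ?subr0.
split.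
- exact: measurable_funB.
- apply: eq_integrable (integrableB mB i1 iE) => // w _.
  by rewrite /= EC EFinB.
- by apply: eq_integrable (integrableB mB i1 ig) => // w _; rewrite /= EFinB.
- move=> C mC.
  have mD : measurable (B `&` W @^-1` C).
    by apply: measurableI => //; rewrite -[_ @^-1` _]setTI; exact: mW.
  have restr f : P.-integrable B f -> P.-integrable (B `&` W @^-1` C) f.
    by apply: integrableS => //; exact: subIsetl.
  under eq_integral do rewrite EC EFinB.
  under [RHS]eq_integral do rewrite EFinB.
  rewrite integralB_EFin//=; [|exact: restr|exact: restr].
  by rewrite integralB_EFin//= ?gE//; exact: restr.
Qed.

End conditional_expectation.

Lemma integral_preimage_indic {d d'} {T : measurableType d} {S : measurableType d'}
    {R : realType} (mu : {measure set T -> \bar R}) (f : T -> R) (V : T -> S) (C : set S) :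
  (\int[mu]_(x in V @^-1` C) (f x)%:E = \int[mu]_x (f x * \1_C (V x))%:E)%E.
Proof.
rewrite integral_mkcond; apply: eq_integral => x _.
rewrite patchE indicE.
have -> : (x \in V @^-1` C) = (V x \in C) by apply/idP/idP; rewrite !inE.
by case: ifPn => _; rewrite ?mulr1 ?mulr0.
Qed.

(** The weights [U] and [g \o W] may change sign, whereas the exchange of weights needs nonnegative
    ones. Adding the same integrable function [c] to both makes them nonnegative; its contribution
    is finite and cancels at the end. *)
Lemma is_cexp_pull {d d'} {T : measurableType d} {S : measurableType d'}
    {R : realType} (P : probability T R) (W : T -> S) (U : T -> R) (g k : S -> R) :
  measurable_fun [set: T] W -> is_cexp P setT W U g ->
  measurable_fun [set: S] k -> (forall x, 0 <= k x <= 1) ->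
  (\int[P]_w (U w * k (W w))%:E = \int[P]_w (g (W w) * k (W w))%:E)%E.
Proof.
move=> mW [mg iU ig gE] mk k01.
have mU : measurable_fun [set: T] U by apply/measurable_EFinP/(measurable_int _ iU).
have mgW : measurable_fun [set: T] (g \o W) by exact: measurableT_comp.
have mkW : measurable_fun [set: T] (k \o W) by exact: measurableT_comp.
have k_le f : P.-integrable setT (EFin \o f) ->
    P.-integrable setT (fun w => (f w * k (W w))%:E).
  move=> /[dup] /(measurable_int _)/measurable_EFinP mf.
  apply: le_integrable => //; first by apply/measurable_EFinP/measurable_funM.
  move=> w _; rewrite !abse_EFin lee_fin normrM ler_piMr//.
  by have /andP[? ?] := k01 (W w); rewrite ger0_norm.
pose c w := `|U w| + `|g (W w)|.
have mc : measurable_fun [set: T] c by apply: measurable_funD; exact: measurableT_comp.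
have ic : P.-integrable setT (EFin \o c).
  by apply: eq_integrable (integrableD measurableT (integrable_abse iU) (integrable_abse ig)).
have u0 w : 0 <= U w + c w.
  by rewrite /c addrA addr_ge0// -lerBlDl sub0r -normrN ler_norm.
have v0 w : 0 <= g (W w) + c w.
  by rewrite /c addrCA addr_ge0// -lerBlDl sub0r -normrN ler_norm.
have E f : P.-integrable setT (EFin \o f) ->
  (\int[P]_w ((f w + c w) * k (W w))%:E =
   \int[P]_w (f w * k (W w))%:E + \int[P]_w (c w * k (W w))%:E)%E.
  move=> fi; rewrite -integralD//; [|exact: k_le|exact: k_le].
  by apply: eq_integral => w _; rewrite mulrDl EFinD.
have : (\int[P]_w ((U w + c w) * k (W w))%:E =
        \int[P]_w ((g (W w) + c w) * k (W w))%:E)%E.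
  apply: (integral_weighted _ _ u0 v0 mW _ mk); [exact: measurable_funD|exact: measurable_funD|].
  move=> C mC.
  have mWC : measurable (W @^-1` C) by rewrite -[_ @^-1` _]setTI; exact: mW.
  have := gE C mC; rewrite setTI => gEC.
  have restr f : P.-integrable setT f -> P.-integrable (W @^-1` C) f by exact: integrableS.
  under eq_integral do rewrite EFinD.
  under [RHS]eq_integral do rewrite EFinD.
  rewrite integralD//=; [|exact: restr|exact: restr].
  by rewrite gEC -integralD//=; exact: restr.
rewrite (E _ iU) (E (g \o W) ig).
move/(congr1 (fun z => z - \int[P]_w (c w * k (W w))%:E)%E).
by rewrite !addeK// integrable_fin_num//; exact: k_le.
Qed.

(** Serves to extend to the whole space an almost sure property of [V] known only on [E]. If C is
    the set where [b] fails, then [u] has integral P(E and V in C) = 0 over the event V in C, and u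
    > 0 makes this event null. *)
Lemma ae_of_weighted {d d'} {T : measurableType d} {S : measurableType d'}
    {R : realType} (P : probability T R) (E : set T) (V : T -> S) (u : T -> R) :
  measurable E -> measurable_fun [set: T] V -> measurable_fun [set: T] u ->
  (forall w, 0 < u w) ->
  (forall C, measurable C ->
    \int[P]_(w in V @^-1` C) (\1_E w)%:E = \int[P]_(w in V @^-1` C) (u w)%:E)%E ->
  forall b : S -> bool, measurable_fun [set: S] b ->
    {ae P, forall w, E w -> b (V w)} -> {ae P, forall w, b (V w)}.
Proof.
move=> mE mV mu_ u0 Eu b mb Eb.
pose C := [set x | ~~ b x].
have mC : measurable C by apply/measurable_pred/measurable_neg.
have mVC : measurable (V @^-1` C) by rewrite -[_ @^-1` _]setTI; exact: mV.
have I0 : (\int[P]_(w in V @^-1` C) (\1_E w)%:E = 0)%E.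
  rewrite (ae_eq_integral (cst 0%E))//= ?integral_cst ?mul0e//.
    by apply/measurable_funTS/measurable_EFinP.
  apply: filterS Eb => w Ew Cw; rewrite indicE.
  case: (boolP (w \in E)) => // /set_mem /Ew bV.
  by move: Cw; rewrite /C/= bV.
rewrite Eu// in I0.
have muVC : measurable_fun (V @^-1` C) (EFin \o u) by apply/measurable_funTS/measurable_EFinP.
have [|N [mN N0 subN]] := (ae_eq_integral_abs P mVC muVC).1.
  rewrite -[RHS]I0; apply: eq_integral => w _.
  by rewrite /= ger0_norm// ltW.
exists N; split => // w /= /negP nb; apply: subN => /=; apply/not_implyP; split => // -[] uw.
by have := u0 w; rewrite uw ltxx.
Qed.

(** Where the constraint [b] fails, the version takes the admissible default value [c]; this happens
    only on a null part of [B]. *)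
Lemma is_cprob_clip {d d'} {T : measurableType d} {S : measurableType d'}
    {R : realType} (P : probability T R) (B : set T) (W : T -> S) (E : set T) (g : S -> R)
    (b : R -> bool) (c : R) : measurable B -> measurable_fun [set: T] W ->
  measurable_fun [set: R] b -> b c -> is_cprob P B W E g ->
  {ae P, forall w, B w -> b (g (W w))} ->
  exists g', [/\ is_cprob P B W E g', forall x, b (g' x) &
    {ae P, forall w, B w -> g' (W w) = g (W w)}].
Proof.
move=> mB mW mb bc gE bg; have [mg _ _ _] := gE.
exists (fun x => if b (g x) then g x else c); split.
- apply: (is_cexp_ae_eq mB mW gE).
    by apply: measurable_fun_ifT => //; exact: measurableT_comp.
  by apply: filterS bg => w h Bw; rewrite h.
- by move=> x; case: ifP.
- by apply: filterS bg => w h Bw; rewrite h.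
Qed.

(** This is the form P(U in C1 | W, V) = P(U in C1 | W) of conditional independence. On a rectangle,
    the product of the two conditional probabilities given W is integrated over W in C3, and the
    factor for V is then turned back into the indicator of V in C2. *)
Lemma cond_indep_weighted {d d1 d2 d3} {T : measurableType d} {S1 : measurableType d1}
    {S2 : measurableType d2} {S3 : measurableType d3} {R : realType}
    (P : probability T R) (U : T -> S1) (V : T -> S2) (W : T -> S3)
    (C1 : set S1) (g : S3 -> R) :
  measurable_fun [set: T] U -> measurable_fun [set: T] V -> measurable_fun [set: T] W ->
  cond_indep P U V W -> measurable C1 -> is_cprob P setT W (U @^-1` C1) g ->
  (forall x, 0 <= g x) ->
  forall C, measurable C ->
    (\int[P]_(w in (fun w => (W w, V w)) @^-1` C) (\1_(U @^-1` C1) w)%:E =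
     \int[P]_(w in (fun w => (W w, V w)) @^-1` C) (g (W w))%:E)%E.
Proof.
move=> mU mV mW UV mC1 gE g0.
have [mg _ ig _] := gE.
have mUC1 : measurable (U @^-1` C1) by rewrite -[_ @^-1` _]setTI; exact: mU.
have mgW : measurable_fun [set: T] (g \o W) by exact: measurableT_comp.
apply: weighted_rectangles => //.
- by rewrite integral_indic// setIT (le_lt_trans (probability_le1 _ _))// ltry.
- move=> C3 C2 mC3 mC2; have [g1 [g2 [h1 h2 h12]]] := UV _ _ mC1 mC2.
  have mVC2 : measurable (V @^-1` C2) by rewrite -[_ @^-1` _]setTI; exact: mV.
  have mWC3 : measurable (W @^-1` C3) by rewrite -[_ @^-1` _]setTI; exact: mW.
  (* The version supplied by [cond_indep] is nonnegative only almost surely, and it is about to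
     serve as a weight. *)
  have [g2' [h2' g2'_ge0 g2'E]] : exists g', [/\ is_cprob P setT W (V @^-1` C2) g',
      forall x, 0 <= g' x & {ae P, forall w, setT w -> g' (W w) = g2 (W w)}].
    apply: (is_cprob_clip (c := 0) measurableT mW _ _ h2) => //.
      exact: measurable_fun_ler.
    by apply: filterS (is_cprob_01 measurableT mW h2) => w h /h /andP[].
  have g1E := is_cexp_unique measurableT mW h1 gE.
  have [mg2' _ _ g2'S] := h2'; have [_ _ ig12 g12S] := h12.
  transitivity (\int[P]_(w in W @^-1` C3) ((g1 \* g2) (W w))%:E)%E.
    rewrite -[W @^-1` C3]setTI -g12S// setTI [LHS]integral_mkcondr.
    apply: eq_integral => w _; rewrite patchE !indicE in_setI.
    by case: (w \in V @^-1` C2); rewrite ?andbT ?andbF.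
  transitivity (\int[P]_(w in W @^-1` C3) (g2' (W w) * g (W w))%:E)%E.
    apply: ae_eq_integral => //.
    - by have := measurable_int _ ig12; exact: measurable_funTS.
    - apply/measurable_funTS/measurable_EFinP/measurable_funM => //.
      exact: measurableT_comp.
    - by apply: filterS2 g1E g2'E => w e1 e2 _; rewrite /= e1// e2// mulrC.
  rewrite integral_preimage_indic.
  under eq_integral do rewrite -mulrA.
  rewrite -(@ge0_integral_weighted _ _ _ _ _ P (\1_(V @^-1` C2)) (g2' \o W) W _ _ _ _ _ _
    (fun x => g x * \1_C3 x))//; last 5 first.
  - exact: measurableT_comp.
  - by move=> w; exact: g2'_ge0.
  - by move=> C mC; rewrite -[_ @^-1` C]setTI; exact: g2'S.
  - exact: measurable_funM.
  - by move=> y; rewrite mulr_ge0.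
  rewrite [RHS]integral_mkcond; apply: eq_integral => w _.
  rewrite patchE !indicE in_setI.
  have -> : (w \in W @^-1` C3) = (W w \in C3) by apply/idP/idP; rewrite !inE.
  by case: (W w \in C3); case: (w \in V @^-1` C2); rewrite /= ?mulr1 ?mulr0 ?mul1r ?mul0r.
Qed.

(** * Missing treatment under MCCAR *)

(** Writing 1/x as x times (x^2)^(-1) leaves a real power of a nonnegative number, which is
    measurable; at x = 0 both sides are 0. *)
Lemma measurable_fun_inv {d} {T : measurableType d} {R : realType} (f : T -> R) :
  measurable_fun [set: T] f -> measurable_fun [set: T] (fun x => (f x)^-1).
Proof.
move=> mf; have -> : (fun x => (f x)^-1) = (fun x => f x * (f x ^+ 2) `^ (-1)).
  apply/funext => x; rewrite powR_inv1 ?sqr_ge0//.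
  by have [->|fx0] := eqVneq (f x) 0; [rewrite mul0r invr0|field].
apply: measurable_funM => //.
by apply: (measurableT_comp (measurable_powR _)); exact: measurable_funX.
Qed.

Lemma measurable_fun_eqb {d} {T : measurableType d} (f g : T -> bool) :
  measurable_fun [set: T] f -> measurable_fun [set: T] g ->
  measurable_fun [set: T] (fun x => f x == g x).
Proof.
move=> mf mg.
have -> : (fun x => f x == g x) = (fun x => f x && g x || ~~ f x && ~~ g x).
  by apply/funext => x; case: (f x) (g x) => [] [].
apply: measurable_or; apply: measurable_and => //; exact: measurable_neg.
Qed.

Lemma indic_pred {T : Type} (R : pzRingType) (b : T -> bool) x :
  \1_[set y | b y] x = (b x)%:R :> R.
Proof.
by rewrite indicE; case: (boolP (b x)) => bx; [rewrite mem_set|rewrite memNset//; exact/negP].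
Qed.

Lemma measurable_fun_boolR {d} {T : measurableType d} (R : realType) (b : T -> bool) :
  measurable_fun [set: T] b -> measurable_fun [set: T] (fun x => (b x)%:R : R).
Proof.
move=> mb; have -> : (fun x => (b x)%:R : R) = \1_[set x | b x].
  by apply/funext => x; rewrite indic_pred.
exact/measurable_indic/measurable_pred.
Qed.

Section missing_treatment.
Context {d dX : measure_display} {T : measurableType d} {SX : measurableType dX}
  {R : realType} (P : probability T R).
Variables (X : T -> SX) (A Ro : T -> bool) (Y : T -> R) (D : SX -> bool).
Hypotheses (mX : measurable_fun [set: T] X) (mA : measurable_fun [set: T] A)
  (mRo : measurable_fun [set: T] Ro) (mY : measurable_fun [set: T] Y)
  (mD : measurable_fun [set: SX] D).
Hypothesis Rign : cond_indep P Ro (fun w => (A w, Y w)) X.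
Variables (ppi : SX -> R) (lam : SX * R -> R).
Hypotheses (ppiE : is_cprob P setT X [set w | Ro w] ppi)
  (ppi01 : forall x, 0 < ppi x <= 1).
Hypotheses
  (lamE : is_cprob P [set w | Ro w] (fun w => (X w, Y w)) [set w | A w = D (X w)] lam)
  (lam01 : forall z, 0 <= lam z <= 1).

Local Notation XY := (fun w => (X w, Y w)).
Local Notation XAY := (fun w => (X w, (A w, Y w))).
Local Notation treated := [set w | A w = D (X w)].

Let mXY : measurable_fun [set: T] XY.
Proof. exact: measurable_fun_pair. Qed.

Let mXAY : measurable_fun [set: T] XAY.
Proof. by apply: measurable_fun_pair => //; exact: measurable_fun_pair. Qed.

Let mI : measurable_fun [set: T] (fun w => A w == D (X w)).
Proof.
by apply: measurable_fun_eqb => //; exact: measurableT_comp.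
Qed.

Lemma measurable_treated : measurable treated.
Proof.
have -> : treated = [set w | A w == D (X w)] by apply/seteqP; split => w /=; [move->|move/eqP].
exact: measurable_pred.
Qed.

Lemma measurable_observed : measurable [set w | Ro w].
Proof. exact: measurable_pred. Qed.

Lemma indic_treated w : \1_treated w = (A w == D (X w))%:R :> R.
Proof.
by rewrite indicE; case: eqP => [e|ne]; [rewrite mem_set|rewrite memNset].
Qed.

Definition bern (b : bool) (q : R) := if b then q else 1 - q.

Lemma bern_ge0 b q : 0 <= q <= 1 -> 0 <= bern b q.
Proof. by case: b => /andP[q0 q1] //=; rewrite subr_ge0. Qed.

Let mppi : measurable_fun [set: SX] ppi. Proof. by case: ppiE. Qed.
Let mlam : measurable_fun [set: SX * R] lam. Proof. by case: lamE. Qed.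

Lemma measurable_bern {d'} {S : measurableType d'} b (q : S -> R) :
  measurable_fun [set: S] q -> measurable_fun [set: S] (fun x => bern b (q x)).
Proof. by case: b => //= mq; exact: measurable_funB. Qed.

(** By R-Ignorability, R given (X, A, Y) is Bernoulli with parameter pi(X): the pair (A, Y) adds
    nothing to X. *)
Lemma observed_law r (h : SX * (bool * R) -> R) : measurable_fun setT h ->
  (\int[P]_w ((Ro w == r)%:R * h (XAY w))%:E =
   \int[P]_w (bern r (ppi (X w)) * h (XAY w))%:E)%E.
Proof.
move=> mh.
have -> : (fun w => ((Ro w == r)%:R * h (XAY w))%:E) =
    (fun w => (\1_(Ro @^-1` [set r]) w * h (XAY w))%:E).
  apply/funext => w; rewrite indicE.
  by case: eqP => [e|ne]; [rewrite mem_set|rewrite memNset].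
have mr : measurable (Ro @^-1` [set r]) by rewrite -[_ @^-1` _]setTI; exact: mRo.
have ppir : is_cprob P setT X (Ro @^-1` [set r]) (fun x => bern r (ppi x)).
  case: r {mr} => /=.
    by rewrite (_ : _ @^-1` _ = [set w | Ro w])//; apply/seteqP; split.
  have -> : Ro @^-1` [set false] = ~` [set w | Ro w].
    by apply/seteqP; split => w /=; case: (Ro w).
  exact: is_cprobC.
have b0 x : 0 <= bern r (ppi x).
  by apply: bern_ge0; have /andP[/ltW -> ->] := ppi01 x.
apply: integral_weighted => //.
- by apply: (measurable_bern r (q := ppi \o X)); exact: measurableT_comp.
- move=> C mC; apply: cond_indep_weighted ppir _ _ _ => //.
  exact: measurable_fun_pair.
Qed.

Lemma observed_law_XY (h : SX * R -> R) : measurable_fun setT h ->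
  (\int[P]_w ((Ro w)%:R * h (XY w))%:E = \int[P]_w (ppi (X w) * h (XY w))%:E)%E.
Proof.
move=> mh.
have := @observed_law true (fun z => h (z.1, z.2.2)).
move=> /=; under eq_integral do rewrite eqb_id.
apply; apply: measurableT_comp => //; apply: measurable_fun_pair => //.
exact: measurableT_comp.
Qed.

Lemma measurable_treated_mul i (h : SX * R -> R) : measurable_fun setT h ->
  measurable_fun [set: SX * (bool * R)]
    (fun z => ((z.2.1 == D z.1) == i)%:R * h (z.1, z.2.2)).
Proof.
move=> mh.
have m1 : measurable_fun [set: SX * (bool * R)] (fun z => z.2.1).
  exact: (measurableT_comp measurable_fst measurable_snd).
have m2 : measurable_fun [set: SX * (bool * R)] (fun z => D z.1).
  exact: (measurableT_comp mD measurable_fst).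
have m3 : measurable_fun [set: SX * (bool * R)] (fun z => (z.1, z.2.2)).
  apply: measurable_fun_pair => //.
  exact: (measurableT_comp measurable_snd measurable_snd).
apply: measurable_funM; last exact: measurableT_comp.
apply: measurable_fun_boolR.
by apply: measurable_fun_eqb => //; exact: measurable_fun_eqb.
Qed.

(** By R-Ignorability the integral of a function of (X, A, Y) over R = 1 is its integral over the
    whole space with weight pi(X). The identity defining [lam] on R = 1 thus holds on the whole
    space with the extra weight pi, which is then divided out. *)
Lemma is_cprob_treated : is_cprob P setT XY treated lam.
Proof.
have [_ i1 i2 lamS] := lamE.
have mlamXY : measurable_fun [set: T] (lam \o XY) by exact: measurableT_comp.
have mItr := measurable_treated.
have mVppi : measurable_fun [set: SX * R] (fun z => (ppi z.1)^-1).
  by apply: (measurable_fun_inv (f := ppi \o fst)); exact: measurableT_comp.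
split => //.
- exact: integrable_indic.
- apply: (@le_integrable _ _ _ P setT measurableT _ (EFin \o cst 1)) => //.
  + exact/measurable_EFinP.
  + move=> w _; rewrite !abse_EFin lee_fin /= normr1.
    by have /andP[? ?] := lam01 (XY w); rewrite ger0_norm.
  + exact: finite_measure_integrable_cst.
move=> C mC; rewrite setTI !integral_preimage_indic.
(* The factor 1/pi goes with the test function, which may be unbounded: the exchange of weights asks
   for no integrability. *)
have E (f : T -> R) : (fun w => (f w * \1_C (XY w))%:E) =
    (fun w => ((ppi (X w) * f w) * (\1_C (XY w) * (ppi (XY w).1)^-1))%:E).
  apply/funext => w /=; congr EFin.
  have /andP[p0 _] := ppi01 (X w).
  by field; rewrite gt_eqF.
rewrite (E \1_treated) (E (lam \o XY)).
apply: (integral_weighted _ _ _ _ mXY _ (h := fun z => \1_C z * (ppi z.1)^-1)).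
- apply: measurable_funM; first exact: measurableT_comp.
  by apply: measurable_indic.
- by apply: measurable_funM => //; exact: measurableT_comp.
- by move=> w; have /andP[/ltW p0 _] := ppi01 (X w); rewrite mulr_ge0.
- move=> w; have /andP[/ltW p0 _] := ppi01 (X w).
  by have /andP[? _] := lam01 (XY w); rewrite mulr_ge0.
- move=> C' mC'; rewrite !integral_preimage_indic.
  have inO f : (\int[P]_(w in [set w | Ro w] `&` XY @^-1` C') (f w)%:E =
      \int[P]_w ((Ro w)%:R * (f w * \1_C' (XY w)))%:E)%E.
    rewrite [LHS]integral_mkcond; apply: eq_integral => w _.
    rewrite patchE in_setI indicE.
    have -> : (w \in XY @^-1` C') = (XY w \in C') by apply/idP/idP; rewrite !inE.
    have -> : (w \in [set w | Ro w]) = Ro w by apply/idP/idP; rewrite !inE.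
    by case: (Ro w); case: (XY w \in C'); rewrite /= ?mulr1 ?mulr0 ?mul1r ?mul0r.
  have /= := lamS _ mC'; rewrite !inO.
  rewrite (observed_law_XY (h := fun z => lam z * \1_C' z)); last exact: measurable_funM.
  move=> lamC.
  transitivity (\int[P]_w (ppi (X w) * (lam (XY w) * \1_C' (XY w)))%:E)%E; last first.
    by apply: eq_integral => w _; rewrite mulrA.
  rewrite -lamC.
  pose h (z : SX * (bool * R)) : R :=
    ((z.2.1 == D z.1) == true)%:R * \1_C' (z.1, z.2.2).
  transitivity (\int[P]_w (ppi (X w) * h (XAY w))%:E)%E.
    by apply: eq_integral => w _; rewrite indic_treated /h /= eqb_id mulrA.
  rewrite -(@observed_law true h); last exact: measurable_treated_mul.
  by apply: eq_integral => w _; rewrite eqb_id indic_treated /h /= eqb_id.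
- exact: measurable_funM.
Qed.


Lemma treated_law i (h : SX * R -> R) : measurable_fun setT h ->
  (\int[P]_w (((A w == D (X w)) == i)%:R * h (XY w))%:E =
   \int[P]_w (bern i (lam (XY w)) * h (XY w))%:E)%E.
Proof.
move=> mh; have mItr := measurable_treated.
pose E := if i then treated else ~` treated.
have mE : measurable E by rewrite /E; case: (i) => //; exact: measurableC.
have EE w : ((A w == D (X w)) == i)%:R = \1_E w :> R.
  rewrite /E; case: (i); first by rewrite eqb_id indic_treated.
  rewrite indicE in_setC; have := indic_treated w; rewrite indicE.
  by case: (_ \in _); case: (_ == _) => //= /eqP; rewrite ?oner_eq0 // eq_sym oner_eq0.
under eq_integral do rewrite EE.
have lamI : is_cprob P setT XY E (fun z => bern i (lam z)).
  rewrite /E; case: (i); first exact: is_cprob_treated.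
  exact: is_cprobC is_cprob_treated.
have [_ _ _ lamS] := lamI.
apply: integral_weighted => //.
- by apply: (measurable_bern i (q := lam \o XY)); exact: measurableT_comp.
- by move=> w; exact: bern_ge0.
- by move=> C mC; rewrite -[_ @^-1` C]setTI; exact: lamS.
Qed.

Definition joint_mass (b : bool * bool) (z : SX * R) : R :=
  bern b.1 (ppi z.1) * bern b.2 (lam z).

Lemma joint_mass_ge0 b z : 0 <= joint_mass b z.
Proof.
by apply: mulr_ge0; apply: bern_ge0 => //; have /andP[/ltW -> ->] := ppi01 z.1.
Qed.

Lemma measurable_joint_mass b : measurable_fun setT (joint_mass b).
Proof.
apply: measurable_funM; last exact: measurable_bern.
apply: (measurable_bern b.1 (q := ppi \o fst)); exact: measurableT_comp.
Qed.

(** R is averaged out given (X, A, Y). Its mass depends on X alone, so it joins the test function of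
    (X, Y) when 1(A = d(X)) is averaged out next. *)
Lemma joint_law b (h : SX * R -> R) : measurable_fun setT h ->
  (\int[P]_w (((Ro w, A w == D (X w)) == b)%:R * h (XY w))%:E =
   \int[P]_w (joint_mass b (XY w) * h (XY w))%:E)%E.
Proof.
move=> mh.
pose k (z : SX * (bool * R)) : R := ((z.2.1 == D z.1) == b.2)%:R * h (z.1, z.2.2).
transitivity (\int[P]_w ((Ro w == b.1)%:R * k (XAY w))%:E)%E.
  by apply: eq_integral => w _; rewrite /k/= mulrA -natrM mulnb; case: (b).
rewrite observed_law; last exact: measurable_treated_mul.
pose l (z : SX * R) : R := bern b.1 (ppi z.1) * h z.
transitivity (\int[P]_w (((A w == D (X w)) == b.2)%:R * l (XY w))%:E)%E.
  by apply: eq_integral => w _; rewrite mulrCA.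
rewrite treated_law; last first.
  apply: measurable_funM => //.
  apply: (measurable_bern b.1 (q := ppi \o fst)); exact: measurableT_comp.
by apply: eq_integral => w _; rewrite mulrCA mulrA.
Qed.

Let mindic_fst (C : set SX) : measurable C ->
  measurable_fun [set: SX * R] (fun z => \1_C z.1 : R).
Proof.
move=> mC; have m1 : measurable_fun [set: SX] (\1_C : SX -> R) by exact: measurable_indic.
exact: (measurableT_comp m1 measurable_fst).
Qed.

(** Tower property: lambda is the probability of A = d(X) given (X, Y), so its mean given X is the
    probability given X. *)
Lemma is_cprob_treated_X g : is_cexp P setT X (fun w => lam (XY w)) g ->
  is_cprob P setT X treated g.
Proof.
move=> [mg il ig gS]; split => //.
  by apply: integrable_indic; exact: measurable_treated.
move=> C mC; rewrite -gS// setTI !integral_preimage_indic.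
under eq_integral do rewrite indic_treated -(eqb_id (A _ == _)).
apply: (@treated_law true (fun z => \1_C z.1)).
exact: mindic_fst.
Qed.

(** The policy is deterministic, so P(A = d(X) | X) is e(X) where d(X) = 1 and 1 - e(X) where d(X) =
    0. A-Positivity keeps both strictly between 0 and 1. *)
Lemma treatment_probability_01 e g : is_cprob P setT X [set w | A w] e ->
  {ae P, forall w, 0 < e (X w) < 1} -> is_cprob P setT X treated g ->
  {ae P, forall w, 0 < g (X w) < 1}.
Proof.
move=> eE e01 gE.
have mA' : measurable [set w | A w] by exact: measurable_pred.
have [e' [e'E e'01 _]] : exists e', [/\ is_cprob P setT X [set w | A w] e',
    forall x, 0 < e' x < 1 & {ae P, forall w, setT w -> e' (X w) = e (X w)}].
  (* Any default in the open interval would do; 1/2 is one. *)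
  apply: (is_cprob_clip (b := fun r => 0 < r < 1) (c := 2^-1) measurableT mX _ _ eE).
  - by apply: measurable_and; exact: measurable_fun_ltr.
  - lra.
  - by apply: filterS e01.
have [me' _ _ e'S] := e'E.
pose q x := bern (D x) (e' x).
have q01 x : 0 < q x < 1.
  by have := e'01 x; rewrite /q; case: (D x) => /=; lra.
have mq : measurable_fun [set: SX] q.
  apply: measurable_fun_ifT => //; exact: measurable_funB.
suff qE : is_cprob P setT X treated q.
  by apply: filterS (is_cexp_unique measurableT mX gE qE) => w ->.
have mqX : measurable_fun [set: T] (q \o X) by exact: measurableT_comp.
split => //.
- by apply: integrable_indic; exact: measurable_treated.
- apply: (@le_integrable _ _ _ P setT measurableT _ (EFin \o cst 1)) => //.
  + exact/measurable_EFinP.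
  + move=> w _; rewrite !abse_EFin lee_fin /= normr1.
    by have /andP[/ltW ? /ltW ?] := q01 (X w); rewrite ger0_norm.
  + exact: finite_measure_integrable_cst.
move=> C mC; rewrite setTI !integral_preimage_indic.
pose h b x : R := (D x == b)%:R * \1_C x.
have mh b : measurable_fun [set: SX] (h b).
  apply: measurable_funM; last exact: measurable_indic.
  by apply: measurable_fun_boolR; exact: measurable_fun_eqb.
have h0 b x : 0 <= h b x by rewrite mulr_ge0.
pose E b := if b then [set w | A w] else ~` [set w | A w].
have mE b : measurable (E b) by rewrite /E; case: b => //; exact: measurableC.
(* Since the value of d(X) selects the weight, the integral is cut according to it, and the law of A
   given X applies to each piece. *)
have split_int (f : bool -> T -> R) : (forall b, measurable_fun setT (f b)) ->
    (forall b w, 0 <= f b w) ->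
    (\int[P]_w (f (D (X w)) w * \1_C (X w))%:E =
     \int[P]_w (f true w * h true (X w))%:E + \int[P]_w (f false w * h false (X w))%:E)%E.
  move=> mf f0.
  have mhX b : measurable_fun [set: T] (h b \o X) by exact: measurableT_comp.
  rewrite -ge0_integralD//; last 4 first.
  - by move=> w _; rewrite lee_fin mulr_ge0.
  - by apply/measurable_EFinP/measurable_funM => //; exact: (mhX true).
  - by move=> w _; rewrite lee_fin mulr_ge0.
  - by apply/measurable_EFinP/measurable_funM => //; exact: (mhX false).
  apply: eq_integral => w _; rewrite -EFinD /h.
  by case: (D (X w)); rewrite /= ?mul0r ?mulr0 ?mul1r ?addr0 ?add0r.
transitivity (\int[P]_w ((fun b w => \1_(E b) w) (D (X w)) w * \1_C (X w))%:E)%E.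
  apply: eq_integral => w _; congr (_ * _)%:E; rewrite indic_treated /E.
  case: (D (X w)); first by rewrite indic_pred eqb_id.
  rewrite indicE in_setC; have := indic_pred R A w; rewrite indicE.
  by case: (A w) (_ \in _) => [] [] //= /eqP; rewrite ?oner_eq0// eq_sym oner_eq0.
rewrite (split_int (fun b w => \1_(E b) w))//; last by move=> b; exact: measurable_indic.
rewrite [RHS](split_int (fun b w => bern b (e' (X w)))); last 2 first.
- by move=> b; apply: (measurable_bern b (q := e' \o X)); exact: measurableT_comp.
- by move=> b w; apply: bern_ge0; have /andP[/ltW-> /ltW->] := e'01 (X w).
have law b : (\int[P]_w (\1_(E b) w * h b (X w))%:E =
    \int[P]_w (bern b (e' (X w)) * h b (X w))%:E)%E.
  have : is_cprob P setT X (E b) (fun x => bern b (e' x)).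
    by rewrite /E; case: b => //; exact: is_cprobC.
  move=> [_ _ _ eS].
  apply: integral_weighted => //.
  - by apply: (measurable_bern b (q := e' \o X)); exact: measurableT_comp.
  - by move=> w; apply: bern_ge0; have /andP[/ltW-> /ltW->] := e'01 (X w).
  - by move=> C' mC'; rewrite -[_ @^-1` _]setTI; exact: eS.
by rewrite !law.
Qed.

Lemma is_cprob_observed_XY : is_cprob P setT XY [set w | Ro w] (fun z => ppi z.1).
Proof.
have [_ _ ippi _] := ppiE; split => //.
- exact: (measurableT_comp mppi measurable_fst).
- by apply: integrable_indic; exact: measurable_observed.
move=> C mC; rewrite setTI !integral_preimage_indic.
rewrite -observed_law_XY; last exact: measurable_indic.
by apply: eq_integral => w _; rewrite indic_pred.
Qed.

(** * Complete cases: treatment observed and equal to the one assigned by the policy *)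

Variable gam : SX -> R.
Hypotheses (gamE : is_cprob P setT X treated gam) (gam01 : forall x, 0 < gam x <= 1).

Let mgam : measurable_fun [set: SX] gam. Proof. by case: gamE. Qed.

Local Notation complete := [set w | A w = D (X w) /\ Ro w].

Lemma measurable_complete : measurable complete.
Proof.
have -> : complete = treated `&` [set w | Ro w] by [].
by apply: measurableI; [exact: measurable_treated|exact: measurable_observed].
Qed.

Lemma indic_complete w : \1_complete w = ((Ro w, A w == D (X w)) == (true, true))%:R :> R.
Proof.
rewrite xpair_eqE !eqb_id indicE; case: (boolP (Ro w)) => /= r.
  by case: eqP => [e|ne]; [rewrite mem_set|rewrite memNset// => -[]].
by rewrite memNset// => -[_]; exact/negP.
Qed.

(** This is eta = pi gamma. The joint law yields pi lambda; as the test function involves only X,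
    lambda is turned back into the indicator of A = d(X), whose probability given X is gamma. *)
Lemma complete_law (h : SX -> R) : measurable_fun setT h ->
  (\int[P]_w (\1_complete w * h (X w))%:E =
   \int[P]_w (ppi (X w) * gam (X w) * h (X w))%:E)%E.
Proof.
move=> mh; under eq_integral do rewrite indic_complete.
rewrite (joint_law _ (h := fun z => h z.1)); last first.
  exact: (measurableT_comp mh measurable_fst).
transitivity (\int[P]_w (lam (XY w) * (ppi (X w) * h (X w)))%:E)%E.
  by apply: eq_integral => w _; rewrite /joint_mass/= mulrCA mulrA.
have mph : measurable_fun setT (fun x => ppi x * h x) by exact: measurable_funM.
have := @treated_law true (fun z => ppi z.1 * h z.1).
move=> /= <-; last exact: (measurableT_comp mph measurable_fst).
under eq_integral do rewrite eqb_id -indic_treated.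
have [_ _ _ gamS] := gamE.
rewrite (integral_weighted (u := \1_treated) (v := gam \o X) (V := X) _ _ _ _ _ _ mph)//.
- by apply: eq_integral => w _; rewrite /= mulrCA mulrA.
- exact/measurable_indic/measurable_treated.
- exact: measurableT_comp.
- by move=> w; have /andP[/ltW] := gam01 (X w).
- by move=> C mC; rewrite -[_ @^-1` C]setTI; exact: gamS.
Qed.

Lemma is_cprob_complete : is_cprob P setT X complete (fun x => ppi x * gam x).
Proof.
split.
- exact: measurable_funM.
- by apply: integrable_indic; exact: measurable_complete.
- apply: (@le_integrable _ _ _ P setT measurableT _ (EFin \o cst 1)) => //.
  + apply/measurable_EFinP; apply: (measurableT_comp _ mX); exact: measurable_funM.
  + move=> w _; rewrite !abse_EFin lee_fin /= normr1.
    have /andP[/ltW p0 p1] := ppi01 (X w); have /andP[/ltW q0 q1] := gam01 (X w).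
    by rewrite ger0_norm ?mulr_ge0// mulr_ile1.
  + exact: finite_measure_integrable_cst.
move=> C mC; rewrite setTI !integral_preimage_indic.
by apply: complete_law; exact: measurable_indic.
Qed.

(** Complete cases have positive probability pi gamma given X, so no non-null set of covariate
    values escapes them. *)
Lemma complete_ae (b : SX -> bool) : measurable_fun [set: SX] b ->
  {ae P, forall w, complete w -> b (X w)} -> {ae P, forall w, b (X w)}.
Proof.
move=> mb; have [mpg _ _ pgS] := is_cprob_complete.
apply: (ae_of_weighted measurable_complete mX (u := fun w => ppi (X w) * gam (X w))) => //.
- exact: (measurableT_comp mpg mX).
- move=> w; have /andP[p0 _] := ppi01 (X w); have /andP[q0 _] := gam01 (X w).
  exact: mulr_gt0.
- by move=> C mC; rewrite -[_ @^-1` C]setTI; exact: pgS.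
Qed.

(** The quotient beta / gamma satisfies the definition of E[Y | X] among complete cases: both sides,
    integrated over X in C, equal the integral of beta pi. Uniqueness gives equality with nu on
    complete cases, and [complete_ae] extends it. *)
Lemma outcome_regression nu beta : is_cexp P complete X Y nu ->
  is_cexp P setT X (fun w => Y w * lam (XY w)) beta ->
  {ae P, forall w, nu (X w) = beta (X w) / gam (X w)}.
Proof.
move=> nuE betaE; have [mnu iY _ _] := nuE; have [mbeta iYl ibeta _] := betaE.
have mB := measurable_complete.
pose q x := beta x * (gam x)^-1.
have mq : measurable_fun [set: SX] q.
  by apply: measurable_funM => //; exact: measurable_fun_inv.
have [mpg _ _ pgS] := is_cprob_complete.
have mpgX : measurable_fun [set: T] (fun w => ppi (X w) * gam (X w)).
  exact: (measurableT_comp mpg mX).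
have pg0 w : 0 <= ppi (X w) * gam (X w).
  by have /andP[/ltW p0 _] := ppi01 (X w); have /andP[/ltW g0 _] := gam01 (X w); exact: mulr_ge0.
have pgq x : ppi x * gam x * q x = beta x * ppi x.
  have /andP[g0 _] := gam01 x; rewrite /q; field; by rewrite gt_eqF.
have restr (f : T -> R) : (fun w => (\1_complete w * f w)%:E) = (EFin \o f) \_ complete.
  apply/funext => w; rewrite patchE indicE.
  by case: (w \in complete); rewrite ?mul1r ?mul0r.
(* The quotient itself need not be integrable over the whole space, but with weight pi gamma it
   becomes beta pi, which is dominated by beta. *)
have iq : P.-integrable complete (EFin \o (q \o X)).
  apply/(integrable_mkcond _ mB); rewrite -restr.
  apply: (integrable_weighted mpgX _ pg0 _ mX _ mq) => //.
  - by move=> C mC; rewrite -[_ @^-1` C]setTI; exact/esym/pgS.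
  apply: (le_integrable measurableT _ _ ibeta).
    by apply/measurable_EFinP/measurable_funM => //; exact: measurableT_comp.
  move=> w _; rewrite !abse_EFin lee_fin pgq normrM ler_piMr//.
  by have /andP[/ltW p0 p1] := ppi01 (X w); rewrite ger0_norm.
have qE : is_cexp P complete X Y q.
  split => // C mC.
  have mk : measurable_fun [set: SX] (fun x => ppi x * \1_C x).
    by apply: measurable_funM => //; exact: measurable_indic.
  have k01 x : 0 <= ppi x * \1_C x <= 1.
    have /andP[/ltW p0 p1] := ppi01 x; rewrite indicE.
    by case: (x \in C); rewrite ?mulr1 ?mulr0 ?p0 ?lexx ?ler01.
  have toT (f : T -> R) : (\int[P]_(w in complete `&` X @^-1` C) (f w)%:E =
      \int[P]_w (\1_complete w * (f w * \1_C (X w)))%:E)%E.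
    rewrite setIC integral_mkcondr -restr.
    rewrite integral_preimage_indic; apply: eq_integral => w _.
    by rewrite mulrA.
  rewrite !toT.
  rewrite (complete_law (h := fun x => q x * \1_C x)); last first.
    by apply: measurable_funM => //; exact: measurable_indic.
  under [RHS]eq_integral do rewrite mulrA pgq -mulrA.
  rewrite -(is_cexp_pull mX betaE mk k01).
  under eq_integral do rewrite indic_complete.
  rewrite (joint_law _ (h := fun z => z.2 * \1_C z.1)); last first.
    apply: measurable_funM => //.
    exact: mindic_fst.
  by apply: eq_integral => w _; rewrite /joint_mass/=; congr EFin; ring.
have := is_cexp_unique mB mX nuE qE.
move=> nuq.
have [] := complete_ae (b := fun x => nu x == q x).
- exact: measurable_fun_eqr.
- by apply: filterS nuq => w h /h /eqP.
- by move=> N [mN N0 sN]; exists N; split => // w h; apply: sN => /eqP; exact: h.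
Qed.

(** * Averages over the four values of (R, 1(A = d(X))) given (X, Y) *)

Variable G : bool * bool -> SX * R -> R.
Hypothesis mG : forall b, measurable_fun setT (G b).

Local Notation GF := (fun w => G (Ro w, A w == D (X w)) (XY w)).

Let GF_sum w : GF w = \sum_b ((Ro w, A w == D (X w)) == b)%:R * G b (XY w).
Proof.
rewrite (bigD1 (Ro w, A w == D (X w)))//= eqxx mul1r big1 ?addr0// => b.
by rewrite eq_sym => /negbTE ->; rewrite mul0r.
Qed.

Let mind b : measurable_fun [set: T] (fun w => ((Ro w, A w == D (X w)) == b)%:R : R).
Proof.
apply: measurable_fun_boolR; apply: measurable_and; exact: measurable_fun_eqb.
Qed.

Let mGXY b : measurable_fun [set: T] (G b \o XY).
Proof. exact: measurableT_comp. Qed.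

Lemma measurable_joint : measurable_fun [set: T] GF.
Proof.
rewrite (_ : GF = fun w => \sum_b ((Ro w, A w == D (X w)) == b)%:R * G b (XY w)).
  by apply: measurable_sum => b; apply: measurable_funM => //; exact: mGXY.
by apply/funext => w; exact: GF_sum.
Qed.

Lemma ge0_integral_joint : (forall b z, 0 <= G b z) ->
  (\int[P]_w (GF w)%:E = \int[P]_w (\sum_b joint_mass b (XY w) * G b (XY w))%:E)%E.
Proof.
move=> G0; under eq_integral do rewrite GF_sum -sumEFin.
under [RHS]eq_integral do rewrite -sumEFin.
rewrite ge0_integral_sum//; last 2 first.
- by move=> b; apply/measurable_EFinP/measurable_funM => //; exact: mGXY.
- by move=> b w _; rewrite lee_fin mulr_ge0.
rewrite ge0_integral_sum//; last 2 first.
- move=> b; apply/measurable_EFinP/measurable_funM; last exact: mGXY.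
  exact: measurableT_comp (measurable_joint_mass b) mXY.
- by move=> b w _; rewrite lee_fin mulr_ge0// joint_mass_ge0.
by apply: eq_bigr => b _; exact: joint_law.
Qed.

(** For a signed function the four terms must be separately integrable before the joint law is
    applied to each. They are, since each is the whole function restricted to one value of (R, 1(A =
    d(X))). *)
Lemma integral_joint_eq0 : P.-integrable setT (EFin \o GF) ->
  (forall z, \sum_b joint_mass b z * G b z = 0) -> (\int[P]_w (GF w)%:E = 0)%E.
Proof.
move=> iG G0; under eq_integral do rewrite GF_sum -sumEFin.
have iGb b : P.-integrable setT
    (fun w => (((Ro w, A w == D (X w)) == b)%:R * G b (XY w))%:E).
  apply: (le_integrable measurableT _ _ iG).
    by apply/measurable_EFinP/measurable_funM => //; exact: mGXY.
  move=> w _; rewrite !abse_EFin lee_fin /=.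
  by case: eqP => [<-|_]; rewrite ?mul1r// mul0r normr0.
rewrite integral_sum//.
under eq_bigr do rewrite joint_law//.
rewrite -integral_sum//; last first.
  move=> b; apply: (integrable_weighted _ _ _ _ mXY _ (mG b) (iGb b)) => //.
  - exact: measurableT_comp (measurable_joint_mass b) mXY.
  - by move=> w; exact: joint_mass_ge0.
  - by move=> C mC; rewrite !integral_preimage_indic joint_law.
by under eq_integral do rewrite sumEFin G0; rewrite integral0.
Qed.

End missing_treatment.

(** * Influence functions and their variances *)

Section influence_functions.
Context {dX : measure_display} {SX : measurableType dX} {R : realType}.
Variables (ppi : SX -> R) (lam : SX * R -> R) (gam nu : SX -> R).
Hypotheses (mppi : measurable_fun [set: SX] ppi) (mlam : measurable_fun setT lam)
  (mgam : measurable_fun [set: SX] gam) (mnu : measurable_fun [set: SX] nu)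
  (ppi_gt0 : forall x, 0 < ppi x) (gam_gt0 : forall x, 0 < gam x).

Definition residual (z : SX * R) : R := (z.2 - nu z.1) / gam z.1.

(* Here b = (R, 1(A = d(X))) and z = (X, Y). *)
Definition inf_MAR (b : bool * bool) (z : SX * R) : R :=
  residual z * (b.1%:R * (b.2%:R - lam z) / ppi z.1 + lam z) + nu z.1.

Definition inf_MCCAR (b : bool * bool) (z : SX * R) : R :=
  b.1%:R * b.2%:R * (z.2 - nu z.1) / (ppi z.1 * gam z.1) + nu z.1.

Definition inf_diff (b : bool * bool) (z : SX * R) : R :=
  residual z * lam z * (b.1%:R / ppi z.1 - 1).

Lemma inf_MCCAR_MAR b z : inf_MCCAR b z = inf_MAR b z + inf_diff b z.
Proof.
rewrite /inf_MCCAR /inf_MAR /inf_diff /residual; field.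
by rewrite !gt_eqF.
Qed.

Let fst_comp (f : SX -> R) : measurable_fun setT f ->
  measurable_fun [set: SX * R] (fun z => f z.1).
Proof. by move=> mf; exact: (measurableT_comp mf measurable_fst). Qed.

Lemma measurable_residual : measurable_fun setT residual.
Proof.
apply: measurable_funM.
  by apply: measurable_funB => //; exact: fst_comp.
by apply: (fst_comp (f := fun x => (gam x)^-1)); exact: measurable_fun_inv.
Qed.

Let mVppi : measurable_fun [set: SX * R] (fun z => (ppi z.1)^-1).
Proof. by apply: (fst_comp (f := fun x => (ppi x)^-1)); exact: measurable_fun_inv. Qed.

Lemma measurable_inf_MAR b : measurable_fun setT (inf_MAR b).
Proof.
apply: measurable_funD; last exact: fst_comp.
apply: measurable_funM; first exact: measurable_residual.
apply: measurable_funD => //; apply: measurable_funM => //.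
by apply: measurable_funM => //; exact: measurable_funB.
Qed.

Lemma measurable_inf_diff b : measurable_fun setT (inf_diff b).
Proof.
apply: measurable_funM.
  by apply: measurable_funM => //; exact: measurable_residual.
by apply: measurable_funB => //; exact: measurable_funM.
Qed.

Let sum_bool2 (F : bool * bool -> R) : \sum_b F b =
  F (true, true) + F (true, false) + (F (false, true) + F (false, false)).
Proof.
rewrite (eq_bigr (fun b => F (b.1, b.2))); last by move=> [].
by rewrite -(pair_bigA _ (fun r i => F (r, i)))/= !big_bool.
Qed.

(** Given (X, Y), only R varies in the difference, and R / pi has mean 1. *)
Lemma mean_inf_diff z : \sum_b joint_mass ppi lam b z * inf_diff b z = 0.
Proof.
rewrite sum_bool2 /joint_mass /inf_diff /=.
by field; rewrite gt_eqF.
Qed.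

(** Given (X, Y), [inf_MAR] is a constant plus a multiple of R (1(A = d(X)) - lambda). The constant
    is killed by the zero mean of R / pi - 1, the other term by the zero mean of 1(A = d(X)) -
    lambda, which is independent of R. *)
Lemma mean_inf_MAR_diff z :
  \sum_b joint_mass ppi lam b z * (inf_MAR b z * inf_diff b z) = 0.
Proof.
rewrite sum_bool2 /joint_mass /inf_MAR /inf_diff /=.
by field; rewrite gt_eqF.
Qed.

(** The factor (1 - pi) / pi is the variance of R / pi given X. *)
Lemma mean_inf_diff_sqr z :
  \sum_b joint_mass ppi lam b z * inf_diff b z ^+ 2 =
  residual z ^+ 2 * lam z ^+ 2 * ((1 - ppi z.1) / ppi z.1).
Proof.
rewrite sum_bool2 /joint_mass /inf_diff /=.
by field; rewrite gt_eqF.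
Qed.

End influence_functions.

Lemma varianceD_orthogonal {d} {T : measurableType d} {R : realType} (P : probability T R)
    (f g : T -> R) : f \in Lfun P 2%:E -> g \in Lfun P 2%:E ->
  ('E_P[g] = 0)%E -> ('E_P[(f * g)%R] = 0)%E -> ('V_P[(f \+ g)%R] = 'V_P[f] + 'E_P[(g ^+ 2)%R])%E.
Proof.
move=> f2 g2 Eg Efg.
have Pfin : P setT \is a fin_num := fin_num_measure P _ measurableT.
have f1 := Lfun_subset12 Pfin f2.
have g1 := Lfun_subset12 Pfin g2.
rewrite varianceD// covarianceE//; last exact: Lfun2_mul_Lfun1.
rewrite Efg Eg mule0 subee// mule0 adde0.
by rewrite [in X in (_ + X)%E]varianceE// Eg expe2 mule0 sube0.
Qed.

Lemma integrable_ae_eq {d} {T : measurableType d} {R : realType}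
    (mu : {measure set T -> \bar R}) (D : set T) (f g : T -> \bar R) :
  measurable D -> measurable_fun D g -> ae_eq mu D f g ->
  mu.-integrable D f -> mu.-integrable D g.
Proof.
move=> mD mg fg /[dup] fi /integrableP[mf foo]; apply/integrableP; split => //.
rewrite -(_ : \int[mu]_(x in D) `|f x| = \int[mu]_(x in D) `|g x|)%E//.
apply: ae_eq_integral => //; [exact: measurableT_comp|exact: measurableT_comp|].
by apply: filterS fg => x h Dx; rewrite h.
Qed.

Lemma is_cexp_ae_eql {d d'} {T : measurableType d} {S : measurableType d'}
    {R : realType} (P : probability T R) (W : T -> S) (U U' : T -> R) (g : S -> R) :
  measurable_fun [set: T] W -> is_cexp P setT W U g ->
  measurable_fun [set: T] U' -> {ae P, forall w, U w = U' w} -> is_cexp P setT W U' g.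
Proof.
move=> mW [mg iU ig gS] mU' UU'.
have mEU' : measurable_fun setT (EFin \o U') by exact/measurable_EFinP.
split => //.
  by apply: (integrable_ae_eq measurableT mEU' _ iU); apply: filterS UU' => w h _; rewrite /= h.
move=> C mC; rewrite -gS// setTI.
have mWC : measurable (W @^-1` C) by rewrite -[_ @^-1` _]setTI; exact: mW.
have mEU := measurable_int _ iU.
apply: ae_eq_integral => //.
- exact: measurable_funTS.
- exact: measurable_funTS.
- by apply: filterS UU' => w h _; rewrite /= h.
Qed.

(** * Variance gain for the given nuisance functions *)

Section efficiency.
Context {d : measure_display} {R : realType} {p : nat} {T : measurableType d}
  (P : probability T R).
Variables (X : T -> p.-tuple R) (A Ro : T -> bool) (Y : T -> R)
  (pol : p.-tuple R -> bool).
Hypotheses (mX : measurable_fun [set: T] X) (mA : measurable_fun [set: T] A)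
  (mRo : measurable_fun [set: T] Ro) (mY : measurable_fun [set: T] Y)
  (mpol : measurable_fun [set: p.-tuple R] pol).
Hypothesis Rign : R_ignorability P X A Ro Y.
Variables (piX : p.-tuple R -> R) (N : nuisance R p).
Hypotheses (Apos : A_positivity P X A) (Rpos : R_positivity P X Ro piX)
  (HN : is_nuisance P X A Ro Y pol N).

Local Notation XY := (fun w => (X w, Y w)).

Let mXY : measurable_fun [set: T] XY.
Proof. exact: measurable_fun_pair. Qed.

(* The nuisance functions are determined only up to null sets; these versions
   satisfy the positivity constraints everywhere. *)
Lemma nuisance_versions : exists (ppi : p.-tuple R -> R)
    (lam : p.-tuple R * R -> R) (gam : p.-tuple R -> R),
  [/\ is_cprob P setT X [set w | Ro w] ppi /\ (forall x, 0 < ppi x <= 1),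
      is_cprob P [set w | Ro w] XY [set w | A w = pol (X w)] lam /\
        (forall z, 0 <= lam z <= 1),
      measurable_fun setT gam /\ (forall x, 0 < gam x <= 1) &
      {ae P, forall w,
        [/\ piX (X w) = ppi (X w), pi_xy N (X w) (Y w) = ppi (X w),
            lambda N (X w) (Y w) = lam (X w, Y w), gamma N (X w) = gam (X w) &
            Defs.eta N (X w) = ppi (X w) * gam (X w) /\
            nu N (X w) = Defs.beta N (X w) / gam (X w)]}].
Proof.
have [piE pi0] := Rpos; have [nuE etaE lamE pixyE betaE gamE] := HN.
have mO : measurable [set w | Ro w] by exact: measurable_pred.
have [ppi [ppiE ppi01 ppi_ae]] : exists ppi, [/\ is_cprob P setT X [set w | Ro w] ppi,
    forall x, 0 < ppi x <= 1 & {ae P, forall w, setT w -> ppi (X w) = piX (X w)}].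
  apply: (is_cprob_clip (b := fun r => 0 < r <= 1) (c := 1) measurableT mX _ _ piE).
  - by apply: measurable_and; [exact: measurable_fun_ltr|exact: measurable_fun_ler].
  - by rewrite ltr01 lexx.
  - by apply: filterS2 pi0 (is_cprob_01 measurableT mX piE) => w -> /(_ I)/andP[_ ->].
have [lam [lam'E lam01 lam_ae]] : exists lam, [/\
    is_cprob P [set w | Ro w] XY [set w | A w = pol (X w)] lam,
    forall z, 0 <= lam z <= 1 &
    {ae P, forall w, Ro w -> lam (XY w) = (fun xy => lambda N xy.1 xy.2) (XY w)}].
  apply: (is_cprob_clip (b := fun r => 0 <= r <= 1) (c := 1) mO mXY _ _ lamE).
  - by apply: measurable_and; exact: measurable_fun_ler.
  - by rewrite ler01 lexx.
  - exact: is_cprob_01 lamE.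
have [mppi _ _ _] := ppiE; have [mlam _ _ _] := lam'E; have [mlam0 _ _ _] := lamE.
have pixy_E := is_cprob_observed_XY mX mA mRo mY Rign ppiE ppi01.
have [_ _ _ pixyS] := pixy_E.
(* Uniqueness identifies the two versions only on R = 1; as pi > 0, the equality extends to the
   whole space. *)
have lamT_ae : {ae P, forall w, lam (XY w) = lambda N (X w) (Y w)}.
  have : {ae P, forall w, (fun z => lam z == lambda N z.1 z.2) (XY w)}.
    apply: (ae_of_weighted mO mXY (u := fun w => ppi (X w)) _ _ _
      (b := fun z => lam z == lambda N z.1 z.2)) => //.
    - exact: measurableT_comp.
    - by move=> w; have /andP[] := ppi01 (X w).
    - by move=> C mC; rewrite -[_ @^-1` C]setTI; exact: pixyS.
    - exact: measurable_fun_eqr.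
    - by apply: filterS lam_ae => w h /h /eqP.
  by apply: filterS => w /eqP.
have mlamXY : measurable_fun [set: T] (fun w => lam (XY w)) by exact: measurableT_comp.
have gam'E : is_cexp P setT X (fun w => lam (XY w)) (gamma N).
  by apply: (is_cexp_ae_eql mX gamE) => //; apply: filterS lamT_ae.
have beta'E : is_cexp P setT X (fun w => Y w * lam (XY w)) (Defs.beta N).
  apply: (is_cexp_ae_eql mX betaE); first exact: measurable_funM.
  by apply: filterS lamT_ae => w ->.
have gamTE := is_cprob_treated_X mX mA mRo mY mpol Rign ppiE ppi01 lam'E lam01 gam'E.
have [e [eE e01]] := Apos.
have gam_pos := treatment_probability_01 mX mA mpol eE e01 gamTE.
have [gam [gam''E gam01 gam_ae]] : exists gam, [/\
    is_cprob P setT X [set w | A w = pol (X w)] gam,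
    forall x, 0 < gam x <= 1 & {ae P, forall w, setT w -> gam (X w) = gamma N (X w)}].
  apply: (is_cprob_clip (b := fun r => 0 < r <= 1) (c := 1) measurableT mX _ _ gamTE).
  - by apply: measurable_and; [exact: measurable_fun_ltr|exact: measurable_fun_ler].
  - by rewrite ltr01 lexx.
  - by apply: filterS gam_pos => w /andP[-> /ltW ->].
exists ppi, lam, gam; split => //.
  by split => //; case: gam''E.
have eta_ae := is_cexp_unique measurableT mX etaE
  (is_cprob_complete mX mA mRo mY mpol Rign ppiE ppi01 lam'E lam01 gam''E gam01).
have nu_ae := outcome_regression mX mA mRo mY mpol Rign ppiE ppi01 lam'E lam01
  gam''E gam01 nuE beta'E.
have pixy_ae := is_cexp_unique measurableT mXY pixyE pixy_E.
have lam_gam : {ae P, forall w, lambda N (X w) (Y w) = lam (X w, Y w) /\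
    gamma N (X w) = gam (X w)}.
  by apply: filterS2 lamT_ae gam_ae => w -> ->.
have eta_nu : {ae P, forall w, Defs.eta N (X w) = ppi (X w) * gam (X w) /\
    nu N (X w) = Defs.beta N (X w) / gam (X w)}.
  by apply: filterS2 eta_ae nu_ae => w e1 e2; rewrite e1// e2.
have pi_ae : {ae P, forall w, piX (X w) = ppi (X w) /\ pi_xy N (X w) (Y w) = ppi (X w)}.
  by apply: filterS2 ppi_ae pixy_ae => w e1 e2; split; [rewrite e1|exact: e2].
by apply: filterS3 pi_ae lam_gam eta_nu => w [? ?] [? ?] [? ?].
Qed.

Local Notation phiC := (phi_MCCAR pol N \o observed X Ro A Y).
Local Notation phiM := (phi_MAR pol N \o observed X Ro A Y).

Definition gain_integrand (w : T) : R :=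
  ((Y w - nu N (X w)) / gamma N (X w)) ^+ 2 * lambda N (X w) (Y w) ^+ 2 *
  ((1 - piX (X w)) / piX (X w)).

(** For the last part, the event has probability (1 - pi) lambda 1(Y != nu) given (X, Y). Since pi
    and gamma are positive, this vanishes exactly where the gain integrand does, and both are
    nonnegative. *)
Lemma efficiency_gain : phiC \in Lfun P 2%:E -> phiM \in Lfun P 2%:E ->
  [/\ ('V_P[phiC] = 'V_P[phiM] + 'E_P[gain_integrand])%E,
      (0 <= 'E_P[gain_integrand])%E &
      ('E_P[gain_integrand] = 0)%E <->
      P [set w | ~~ Ro w /\ A w = pol (X w) /\ Y w != nu N (X w)] = 0%E].
Proof.
move=> C2 M2; have [ppi [lam [gam [[ppiE ppi01] [lamE lam01] [mgam gam01] nuis]]]] :=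
  nuisance_versions.
have [mppi _ _ _] := ppiE; have [mlam _ _ _] := lamE; have [mnu _ _ _] := nuP HN.
have ppi0 x : 0 < ppi x by have /andP[] := ppi01 x.
have gam0 x : 0 < gam x by have /andP[] := gam01 x.
pose I w := A w == pol (X w).
pose FM b z := inf_MAR ppi lam gam (nu N) b z.
pose FD b z := inf_diff ppi lam gam (nu N) b z.
have mFM b : measurable_fun setT (FM b) by exact: measurable_inf_MAR.
have mFD b : measurable_fun setT (FD b) by exact: measurable_inf_diff.
have M_ae : {ae P, forall w, phiM w = FM (Ro w, I w) (XY w)}.
  apply: filterS nuis => w [_ e2 e3 e4 [_ e6]].
  rewrite /= /observed /FM /inf_MAR /residual /= e2 e3 e4 e6 /I.
  (* For R = 0 the observed RA is 0 whatever A is, but the factor R removes the indicator. *)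
  by case: (Ro w) => //=; rewrite !mul0r.
have C_ae : {ae P, forall w, phiC w = FM (Ro w, I w) (XY w) + FD (Ro w, I w) (XY w)}.
  apply: filterS nuis => w [_ _ _ _ [e5 _]].
  rewrite -inf_MCCAR_MAR// /= /observed /inf_MCCAR /= e5 /I.
  by case: (Ro w) => //=; rewrite !mul0r.
pose dlt : T -> R := phiC \- phiM.
have D_ae : {ae P, forall w, dlt w = FD (Ro w, I w) (XY w)}.
  by apply: filterS2 M_ae C_ae => w e1 e2; rewrite -[dlt w]/(phiC w - phiM w) e1 e2 addrC addKr.
have D2 : dlt \in Lfun P 2%:E by rewrite rpredB// lee1n.
have joint_meas (G : bool * bool -> p.-tuple R * R -> R) :
    (forall b, measurable_fun setT (G b)) ->
    measurable_fun setT (fun w => G (Ro w, I w) (XY w)) by exact: measurable_joint.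
have Pfin : P setT \is a fin_num := fin_num_measure P _ measurableT.
(* Carries a zero mean, established by pointwise algebra for the chosen versions, over to functions
   that agree with them almost surely. *)
have law0 (f : T -> R) (G : bool * bool -> p.-tuple R * R -> R) :
    (forall b, measurable_fun setT (G b)) ->
    f \in Lfun P 1 -> {ae P, forall w, f w = G (Ro w, I w) (XY w)} ->
    (forall z, \sum_b joint_mass ppi lam b z * G b z = 0) -> ('E_P[f] = 0)%E.
  move=> mG f1 fG G0.
  have mEG : measurable_fun setT (fun w => (G (Ro w, I w) (XY w))%:E).
    by apply/measurable_EFinP; exact: joint_meas.
  have fi : P.-integrable setT (EFin \o f) by exact/Lfun1_integrable.
  have fGE : ae_eq P setT (EFin \o f) (fun w => (G (Ro w, I w) (XY w))%:E).
    by apply: filterS fG => w h _; rewrite /= h.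
  rewrite unlock; transitivity (\int[P]_w (G (Ro w, I w) (XY w))%:E)%E.
    by apply: ae_eq_integral fGE => //; exact: measurable_int fi.
  apply: (integral_joint_eq0 mX mA mRo mY mpol Rign ppiE ppi01 lamE lam01 mG) => //.
  exact: integrable_ae_eq fGE fi.
have ED : ('E_P[dlt] = 0)%E.
  apply: law0 D_ae _ => //; first exact: Lfun_subset12.
  by move=> z; exact: mean_inf_diff.
have EMD : ('E_P[(phiM * dlt)%R] = 0)%E.
  apply: (law0 _ (fun b z => FM b z * FD b z)).
  - by move=> b; exact: measurable_funM.
  - exact: Lfun2_mul_Lfun1.
  - by apply: filterS2 M_ae D_ae => w e1 e2; rewrite -e1 -e2.
  - by move=> z; exact: mean_inf_MAR_diff.
pose k (z : p.-tuple R * R) : R :=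
  residual gam (nu N) z ^+ 2 * lam z ^+ 2 * ((1 - ppi z.1) / ppi z.1).
have k0 z : 0 <= k z.
  have /andP[/ltW p0 p1] := ppi01 z.1.
  by rewrite mulr_ge0 ?divr_ge0 ?subr_ge0// mulr_ge0// sqr_ge0.
have mpi1 : measurable_fun [set: p.-tuple R * R] (fun z => ppi z.1).
  exact: (measurableT_comp mppi measurable_fst).
have mk : measurable_fun setT k.
  apply: measurable_funM.
    apply: measurable_funM; apply: measurable_funX => //; exact: measurable_residual.
  apply: measurable_funM; first exact: measurable_funB.
  exact: measurable_fun_inv.
have mkXY : measurable_fun setT (k \o XY) by exact: measurableT_comp.
have gain_ae : {ae P, forall w, gain_integrand w = k (XY w)}.
  by apply: filterS nuis => w [e1 _ e3 e4 _]; rewrite /gain_integrand /k /residual /= e1 e3 e4.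
have mgain : measurable_fun setT gain_integrand.
  have [mpiX _ _ _] := Rpos.1; have [mlamN _ _ _] := lambdaP HN.
  have [mgamN _ _ _] := gammaP HN.
  have mlamXY : measurable_fun setT (fun w => lambda N (X w) (Y w)).
    exact: (measurableT_comp mlamN mXY).
  have mpiXX : measurable_fun setT (fun w => piX (X w)) by exact: (measurableT_comp mpiX mX).
  apply: measurable_funM.
    apply: measurable_funM; apply: measurable_funX => //.
    apply: measurable_funM.
      by apply: measurable_funB => //; exact: (measurableT_comp mnu mX).
    by apply: measurable_fun_inv; exact: (measurableT_comp mgamN mX).
  by apply: measurable_funM; [exact: measurable_funB|exact: measurable_fun_inv].
have gainE : ('E_P[gain_integrand] = \int[P]_w (k (XY w))%:E)%E.
  rewrite unlock; apply: ae_eq_integral => //.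
  - exact/measurable_EFinP.
  - exact/measurable_EFinP.
  - by apply: filterS gain_ae => w h _; rewrite /= h.
split.
- have -> : phiC = phiM \+ dlt.
    apply/funext => w; rewrite -[RHS]/(phiM w + (phiC w - phiM w)) [RHS]addrC.
    by rewrite subrK.
  rewrite varianceD_orthogonal// gainE; congr (_ + _)%E.
  have mFD2 b : measurable_fun setT (fun z => FD b z ^+ 2) by exact: measurable_funX.
  transitivity (\int[P]_w (FD (Ro w, I w) (XY w) ^+ 2)%:E)%E.
    rewrite unlock; apply: ae_eq_integral => //.
    + apply/measurable_EFinP; apply: (measurable_funX 2 (f := dlt)).
      by move: D2; rewrite inE => /andP[] /[!inE].
    + apply/measurable_EFinP; exact: (joint_meas (fun b z => FD b z ^+ 2)).
    + by apply: filterS D_ae => w h _; rewrite -[LHS]/((dlt w ^+ 2)%:E) h.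
  rewrite (ge0_integral_joint mX mA mRo mY mpol Rign ppiE ppi01 lamE lam01 mFD2); last first.
    by move=> b z; exact: sqr_ge0.
  by apply: eq_integral => w _; rewrite mean_inf_diff_sqr.
- by rewrite gainE; apply: integral_ge0 => w _; rewrite lee_fin.
pose e (z : p.-tuple R * R) : R := (z.2 != nu N z.1)%:R.
have mnu1 : measurable_fun [set: p.-tuple R * R] (fun z => nu N z.1).
  exact: (measurableT_comp mnu measurable_fst).
have me : measurable_fun setT e.
  apply: measurable_fun_boolR; apply: measurable_neg.
  by apply: measurable_fun_eqr.
(* The index (false, true) stands for a missing treatment that equals d(X). *)
pose q z := joint_mass ppi lam (false, true) z * e z.
have mq : measurable_fun setT q by exact: (measurable_funM (measurable_joint_mass ppiE lamE _) me).
have mqXY : measurable_fun setT (q \o XY) by exact: measurableT_comp.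
have q0 z : 0 <= q z.
  by apply: mulr_ge0 => //; exact: joint_mass_ge0 ppi01 lam01 _ _.
have PE : (P [set w | ~~ Ro w /\ A w = pol (X w) /\ Y w != nu N (X w)] =
    \int[P]_w (q (XY w))%:E)%E.
  rewrite -(joint_law mX mA mRo mY mpol Rign ppiE ppi01 lamE lam01 (false, true) me).
  have -> : [set w | ~~ Ro w /\ A w = pol (X w) /\ Y w != nu N (X w)] =
      [set w | ~~ Ro w && I w && (Y w != nu N (X w))].
    apply/seteqP; split => w /=; first by move=> [-> [/eqP AI ->]]; rewrite /I AI.
    by move=> /andP[/andP[-> /eqP AI] ->].
  have mI : measurable_fun [set: T] I.
    by apply: measurable_fun_eqb => //; exact: (measurableT_comp mpol mX).
  have mYnu : measurable_fun [set: T] (fun w => Y w != nu N (X w)).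
    by apply: measurable_neg; apply: measurable_fun_eqr => //; exact: (measurableT_comp mnu mX).
  have mS : measurable [set w | ~~ Ro w && I w && (Y w != nu N (X w))].
    apply: measurable_pred; apply: measurable_and => //.
    by apply: measurable_and => //; exact: measurable_neg.
  transitivity (\int[P]_w (\1_[set w | ~~ Ro w && I w && (Y w != nu N (X w))] w)%:E)%E.
    by rewrite integral_indic// setIT.
  apply: eq_integral => w _; rewrite indic_pred /e -natrM mulnb xpair_eqE /=.
  rewrite /I. by case: (Ro w); case: (A w == _).
have qk z : q z = 0 <-> k z = 0.
  have p0 := ppi0 z.1; have g0 := gam0 z.1.
  suff E : (q z == 0) = (k z == 0) by split => /eqP; [rewrite E|rewrite -E] => /eqP.
  rewrite /q /k /joint_mass /bern /e /residual /=.
  rewrite !mulf_eq0 !invr_eq0 (gt_eqF p0) (gt_eqF g0) !orbF !orbb.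
  rewrite subr_eq0 pnatr_eq0 eqb0 negbK.
  by rewrite (subr_eq0 z.2); case: (1 == _); case: (lam z == 0); case: (z.2 == _).
have int0 (f : p.-tuple R * R -> R) : measurable_fun setT f -> (forall z, 0 <= f z) ->
    (\int[P]_w (f (XY w))%:E = 0)%E <-> {ae P, forall w, f (XY w) = 0}.
  move=> mf f0.
  have mfXY : measurable_fun setT (EFin \o (f \o XY)).
    by apply/measurable_EFinP; exact: measurableT_comp.
  have -> : (\int[P]_w (f (XY w))%:E = \int[P]_w `|(f (XY w))%:E|)%E.
    by apply: eq_integral => w _; rewrite gee0_abs// lee_fin.
  have [h1 h2] := ae_eq_integral_abs P measurableT mfXY.
  split => [/h1|h]; first by apply: filterS => w /(_ Logic.I) [].
  by apply: h2; apply: filterS h => w h _; rewrite /= h.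
rewrite gainE PE; split => [/(int0 _ mk k0) h|/(int0 _ mq q0) h].
- by apply/(int0 _ mq q0); apply: filterS h => w /qk.
- by apply/(int0 _ mk k0); apply: filterS h => w /qk.
Qed.

End efficiency.

(** The ratio can equal 1, for instance when R = 1 almost surely, so strictness is stated together
    with the exact condition for it. Asymptotic normality includes positive variances, which makes
    the quotients meaningful. *)
Theorem theorem3p4 (R : realType) (p : nat)
  (* population: covariates, treatment, missingness, outcomes *)
  (dT : measure_display) (T : measurableType dT) (P : probability T R)
  (calX : set (p.-tuple R)) (mcalX : measurable calX)
  (X : {RV P >-> p.-tuple R}) (XcalX : forall w, calX (X w))
  (A Ro : {RV P >-> bool}) (Y : {RV P >-> R}) (Ypot : bool -> {RV P >-> R})
  (Ybounded : exists M : R, {ae P, forall w, `|Y w| <= M})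
  (* policy *)
  (pol : p.-tuple R -> bool) (mpol : measurable_fun calX pol)
  (* (i) *)
  (cons : consistency P A Y Ypot)
  (Aign : A_ignorability P X A Ypot)
  (Apos : A_positivity P X A)
  (* (ii) *)
  (Rign : R_ignorability P X A Ro Y)
  (piX : p.-tuple R -> R) (Rpos : R_positivity P X Ro piX)
  (* nuisance functions; finite variance of the influence functions *)
  (N : nuisance R p) (HN : is_nuisance P X A Ro Y pol N)
  (MCCAR2 : phi_MCCAR pol N \o observed X Ro A Y \in Lfun P 2%:E)
  (MAR2 : phi_MAR pol N \o observed X Ro A Y \in Lfun P 2%:E)
  (* i.i.d. copies: evaluation sample Zs and independent training sample Zt *)
  (dS : measure_display) (S : measurableType dS) (Q : probability S R)
  (Zs Zt : nat -> {RV Q >-> obs R p})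
  (iid : iid_copies P
    (fun k : nat + nat => match k with inl i => Zs i | inr j => Zt j end)
    (observed X Ro A Y))
  (m : nat -> nat) (Nhat : forall n, (m n).-tuple (obs R p) -> nuisance R p) :
  let Vd := fine 'E_P[fun w => Ypot (pol (X w)) w] in
  let var_MCCAR := fine 'V_P[phi_MCCAR pol N \o observed X Ro A Y] in
  let var_MAR := fine 'V_P[phi_MAR pol N \o observed X Ro A Y] in
  let Phi_hat := estimator (phi_MCCAR pol) Nhat Zs Zt in
  let psi_hat := estimator (phi_MAR pol) Nhat Zs Zt in
  let gain := fine 'E_P[fun w =>
    ((Y w - nu N (X w)) / gamma N (X w)) ^+ 2 * lambda N (X w) (Y w) ^+ 2 *
    ((1 - piX (X w)) / piX (X w))] in
  asymptotically_normal Q psi_hat Vd var_MAR ->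
  asymptotically_normal Q Phi_hat Vd var_MCCAR ->
  [/\ is_ARE Q Phi_hat psi_hat Vd (var_MCCAR / var_MAR),
      var_MCCAR / var_MAR = (1 - gain / var_MCCAR)^-1,
      1 <= var_MCCAR / var_MAR &
      (* strict, except in the degenerate case in which no unit whose treatment
         is missing and equal to d(X) has an outcome other than nu_d(X) *)
      1 < var_MCCAR / var_MAR <->
      (0 < P [set w | ~~ Ro w /\ A w = pol (X w) /\ Y w != nu N (X w)])%E].
Proof.
move=> Vd vC vM Phi_hat psi_hat gain asyM asyC.
(* The policy is measurable on [calX] only. Its extension by [false] is measurable everywhere and
   agrees with it along [X], which takes its values in [calX]. *)
pose D x := (x \in calX) && pol x.
have mD : measurable_fun [set: p.-tuple R] D.
  apply: (measurable_fun_bool true) => //; rewrite setTI.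
  have -> : D @^-1` [set true] = calX `&` pol @^-1` [set true].
    by apply/seteqP; split => x; rewrite /D /=; [move=> /andP[/set_mem]|move=> [/mem_set-> ->]].
  exact: mpol.
have DE w : D (X w) = pol (X w) by rewrite /D mem_set.
have HND : is_nuisance P X A Ro Y D N.
  have E1 : [set w | A w = D (X w)] = [set w | A w = pol (X w)].
    by apply/seteqP; split => w /=; rewrite DE.
  have E2 : [set w | A w = D (X w) /\ Ro w] = [set w | A w = pol (X w) /\ Ro w].
    by apply/seteqP; split => w /=; rewrite DE.
  by case: HN => *; split; rewrite ?E1 ?E2.
have CE : phi_MCCAR D N \o observed X Ro A Y = phi_MCCAR pol N \o observed X Ro A Y.
  by apply/funext => w; rewrite /= /observed /= DE.
have ME : phi_MAR D N \o observed X Ro A Y = phi_MAR pol N \o observed X Ro A Y.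
  by apply/funext => w; rewrite /= /observed /= DE.
have SE : [set w | ~~ Ro w /\ A w = D (X w) /\ Y w != nu N (X w)] =
    [set w | ~~ Ro w /\ A w = pol (X w) /\ Y w != nu N (X w)].
  by apply/seteqP; split => w /=; rewrite DE.
have := @efficiency_gain _ _ _ _ P X A Ro Y D (measurable_funP X) (measurable_funP A)
  (measurable_funP Ro) (measurable_funP Y) mD Rign piX N Apos Rpos HND.
rewrite CE ME SE => /(_ MCCAR2 MAR2)[varE gain_ge0 gain_eq0].
have fM := variance_fin_num MAR2; have fC := variance_fin_num MCCAR2.
(* The gain is finite as a summand of the finite variance of [phi_MCCAR]. *)
have fG : ('E_P[gain_integrand X Y piX N] \is a fin_num)%E.
  move: fC; rewrite varE fin_numD => /andP[_ ->//].
have vE : vC = vM + gain by rewrite /vC varE fineD.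
have g0 : 0 <= gain by exact: fine_ge0.
have [vM0 _] := asyM; have [vC0 _] := asyC.
have ratio : vC / vM = (1 - gain / vC)^-1.
  have -> : 1 - gain / vC = vM / vC.
    by rewrite -[X in X - _](divff (lt0r_neq0 vC0)) -mulrBl {1}vE addrK.
  by rewrite invf_div.
split => //.
- by exists vC, vM; split.
- by rewrite ler_pdivlMr// mul1r vE lerDl.
rewrite ltr_pdivlMr// mul1r vE ltrDl lt0e measure_ge0 andbT lt_def g0 andbT.
split => /eqP h; apply/eqP => h0; apply: h.
- by rewrite /gain gain_eq0.2.
- by apply: gain_eq0.1; rewrite -[LHS]fineK// -/gain h0.
Qed.
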